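(* Let $S$ be a Banach space with a normalized basis $(s_j)_{j=1}^\infty$ whose normalized associated coordinate functionals $(s_j^* )_{j=1}^\infty$ form a subsymmetric weak$^*$ Schauder basis of $S^*$, and assume that $S^*$ together with $(s_j^* )_{j=1}^\infty$ satisfies condition (C). Then for every bounded linear operator $T : S^*\to S^*$ there exist bounded linear operators $M, N : S^*\to S^*$ such that, for $H = T$ or for $H = \mathrm{Id}_{S^*}-T$, $$ N H M = \mathrm{Id}_{S^*} \qquad\text{and}\qquad \|M\|\,\|N\| \le 48 K_u^7 K_s^4 .$$ Consequently, $H(S^* )$ contains a subspace which is isomorphic to $S^*$ and complemented in $S^*$.
   Context: Weak$^*$ Schauder basis: for a Banach space $X$ with a basis $(e_j)$, the associated coordinate functionals $(e_j^* )\subset X^*$ (so $\langle e_j^*,e_i\rangle=\delta_{ij}$) form a weak$^*$ Schauder basis of $X^*$ if every $x^*\in X^*$ satisfies $x^* = \text{weak}^*\text{-}\lim_{n\to\infty}\sum_{j=1}^n \langle x^*,e_j\rangle e_j^*$. All series in $X^*$ are understood as weak$^*$ limits of partial sums. Unconditional: there is $C\ge1$ with $\|\sum_j \gamma_j a_j e_j^*\| \le C\sup_j|\gamma_j|\,\|\sum_j a_je_j^*\|$ for all $(\gamma_j)\in\ell^\infty$ and all scalars $(a_j)$ with $\sum_j a_je_j^*\in X^*$; $K_u$ is the infimum of such $C$. Subsymmetric: $(e_j^* )$ is unconditional and, for every increasing sequence $(n_j)\subset\mathbb{N}$, the operator $S_{(n_j)}(\sum_j a_je_j^* ) = \sum_j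 a_j e_{n_j}^*$ is an isomorphism of $X^*$ onto the weak$^*$-closed span of $\{e_{n_j}^*\}$; $K_s = \sup\{\|S_{(n_j)}\|,\|S_{(n_j)}^{-1}\|\}$ over all increasing sequences (which is finite). Condition (C): Let $U$ be a Banach space with normalized unconditional basis $(e_j)$ whose normalized coordinate functionals $(e_j^* )$ form an unconditional weak$^*$ Schauder basis of $U^*$. For $\mathcal{A}\subset\mathbb{N}$ let $P_{\mathcal{A}}(\sum_j a_je_j^* ) = \sum_{j\in\mathcal{A}} a_je_j^*$. $U^*$ with $(e_j^* )$ satisfies condition (C) if for every infinite $\Lambda\subset\mathbb{N}$ and every $\theta>0$ there is a sequence $(\mathcal{A}_j)_{j\ge1}$ of pairwise disjoint infinite subsets of $\Lambda$ such that for every sequence $(x_j^* )\subset U^*$ with $\|x_j^*\|\le1$ there exist scalars $(a_j)\in\ell^1$ with $\|(a_j)\|_{\ell^1}=1$ and $\|\sum_{j=1}^\infty a_jP_{\mathcal{A}_j}x_j^*\|_{U^*}\le\theta$ (the series converging weak$^*$). *)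

(* Defs.v *)
From Stdlib Require Import Reals List ClassicalEpsilon FunctionalExtensionality.
Open Scope R_scope.

Definition is_glb (E : R -> Prop) (m : R) : Prop :=
  (forall x, E x -> m <= x) /\ (forall b, (forall x, E x -> b <= x) -> b <= m).

Definition Rsup (E : R -> Prop) : R := epsilon (inhabits 0) (fun m => is_lub E m).
Definition Rinf (E : R -> Prop) : R := epsilon (inhabits 0) (fun m => is_glb E m).

Fixpoint psum (g : nat -> R) (n : nat) : R :=
  match n with O => 0 | S k => psum g k + g k end.

Record NormedSpace := {
  nv_car :> Type;
  nv_zero : nv_car;
  nv_add : nv_car -> nv_car -> nv_car;
  nv_opp : nv_car -> nv_car;
  nv_scal : R -> nv_car -> nv_car;
  nv_norm : nv_car -> R;
  nv_addA : forall x y z, nv_add x (nv_add y z) = nv_add (nv_add x y) z;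
  nv_addC : forall x y, nv_add x y = nv_add y x;
  nv_add0 : forall x, nv_add x nv_zero = x;
  nv_addN : forall x, nv_add x (nv_opp x) = nv_zero;
  nv_scal1 : forall x, nv_scal 1 x = x;
  nv_scalA : forall a b x, nv_scal a (nv_scal b x) = nv_scal (a * b) x;
  nv_scalDr : forall a x y, nv_scal a (nv_add x y) = nv_add (nv_scal a x) (nv_scal a y);
  nv_scalDl : forall a b x, nv_scal (a + b) x = nv_add (nv_scal a x) (nv_scal b x);
  nv_norm_eq0 : forall x, nv_norm x = 0 -> x = nv_zero;
  nv_normZ : forall a x, nv_norm (nv_scal a x) = Rabs a * nv_norm x;
  nv_normD : forall x y, nv_norm (nv_add x y) <= nv_norm x + nv_norm y
}.
Arguments nv_zero {_}. Arguments nv_add {_}. Arguments nv_opp {_}.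
Arguments nv_scal {_}. Arguments nv_norm {_}.

Section Banach.
Variable X : NormedSpace.

Definition nv_sub (x y : X) : X := nv_add x (nv_opp y).

Definition complete : Prop :=
  forall u : nat -> X,
    (forall eps, eps > 0 -> exists N, forall n m, (n >= N)%nat -> (m >= N)%nat ->
        nv_norm (nv_sub (u n) (u m)) < eps) ->
    exists l : X, Un_cv (fun n => nv_norm (nv_sub (u n) l)) 0.

Fixpoint vsum (f : nat -> X) (n : nat) : X :=
  match n with O => nv_zero | S k => nv_add (vsum f k) (f k) end.

Definition is_basis (e : nat -> X) : Prop :=
  forall x : X, exists! a : nat -> R,
    Un_cv (fun n => nv_norm (nv_sub (vsum (fun j => nv_scal (a j) (e j)) n) x)) 0.

Definition is_linear_fun (f : X -> R) : Prop :=
  (forall x y, f (nv_add x y) = f x + f y) /\ (forall c x, f (nv_scal c x) = c * f x).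

Definition in_dual (f : X -> R) : Prop :=
  is_linear_fun f /\ exists C, forall x, Rabs (f x) <= C * nv_norm x.

Definition dnorm (f : X -> R) : R :=
  Rsup (fun r => exists x, nv_norm x <= 1 /\ r = Rabs (f x)).

Definition dzero : X -> R := fun _ => 0.
Definition dadd (f g : X -> R) : X -> R := fun x => f x + g x.
Definition dsub (f g : X -> R) : X -> R := fun x => f x - g x.
Definition dscal (c : R) (f : X -> R) : X -> R := fun x => c * f x.

Definition bounded_op (T : (X -> R) -> (X -> R)) : Prop :=
  (forall f, in_dual f -> in_dual (T f)) /\
  (forall f g, in_dual f -> in_dual g -> T (dadd f g) = dadd (T f) (T g)) /\
  (forall c f, in_dual f -> T (dscal c f) = dscal c (T f)) /\
  (exists C, forall f, in_dual f -> dnorm (T f) <= C * dnorm f).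

Definition opnorm_on (P : (X -> R) -> Prop) (T : (X -> R) -> (X -> R)) : R :=
  Rsup (fun r => exists f, P f /\ dnorm f <= 1 /\ r = dnorm (T f)).
Definition opnorm (T : (X -> R) -> (X -> R)) : R := opnorm_on in_dual T.

Definition wstar_sum (fs : nat -> X -> R) (a : nat -> R) (g : X -> R) : Prop :=
  forall x, Un_cv (fun n => psum (fun j => a j * fs j x) n) (g x).

Definition coord_functionals (e : nat -> X) (es : nat -> X -> R) : Prop :=
  forall j, in_dual (es j) /\ forall i, es j (e i) = if Nat.eqb i j then 1 else 0.

Definition wstar_basis (e : nat -> X) (es : nat -> X -> R) : Prop :=
  forall f, in_dual f -> wstar_sum es (fun j => f (e j)) f.

Definition bounded_seq (g : nat -> R) : Prop := exists M, forall j, Rabs (g j) <= M.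
Definition linf_norm (g : nat -> R) : R := Rsup (fun r => exists j, r = Rabs (g j)).

Definition unc_const (es : nat -> X -> R) (C : R) : Prop :=
  1 <= C /\
  forall (gam a : nat -> R) (f : X -> R),
    bounded_seq gam -> in_dual f -> wstar_sum es a f ->
    exists g, in_dual g /\ wstar_sum es (fun j => gam j * a j) g /\
              dnorm g <= C * linf_norm gam * dnorm f.

Definition unconditional (es : nat -> X -> R) : Prop := exists C, unc_const es C.
Definition Ku (es : nat -> X -> R) : R := Rinf (unc_const es).

Definition strictly_incr (n : nat -> nat) : Prop := forall i, (n i < n (S i))%nat.

Definition span_sub (es : nat -> X -> R) (n : nat -> nat) (h : X -> R) : Prop :=
  exists (N : nat) (c : nat -> R), forall x, h x = psum (fun j => c j * es (n j) x) N.

(* weak*-closure in the dual of the span of {es_{n_j}}: every basic weak*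
   neighbourhood of g meets the span *)
Definition wstar_closed_span (es : nat -> X -> R) (n : nat -> nat) (g : X -> R) : Prop :=
  in_dual g /\
  forall (xs : list X) (eps : R), eps > 0 ->
    exists h, span_sub es n h /\ forall x, In x xs -> Rabs (h x - g x) < eps.

Definition shift_iso (e : nat -> X) (es : nat -> X -> R) (n : nat -> nat)
    (Sop Sinv : (X -> R) -> (X -> R)) : Prop :=
  bounded_op Sop /\
  (forall f, in_dual f -> wstar_sum (fun j => es (n j)) (fun j => f (e j)) (Sop f)) /\
  (forall f, in_dual f -> wstar_closed_span es n (Sop f)) /\
  (forall f, in_dual f -> Sinv (Sop f) = f) /\
  (forall g, wstar_closed_span es n g -> in_dual (Sinv g) /\ Sop (Sinv g) = g) /\
  (exists C, forall g, wstar_closed_span es n g -> dnorm (Sinv g) <= C * dnorm g).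

Definition subsymmetric (e : nat -> X) (es : nat -> X -> R) : Prop :=
  unconditional es /\
  forall n, strictly_incr n -> exists Sop Sinv, shift_iso e es n Sop Sinv.

Definition Ks_set (e : nat -> X) (es : nat -> X -> R) (r : R) : Prop :=
  exists n Sop Sinv, strictly_incr n /\ shift_iso e es n Sop Sinv /\
    (r = opnorm Sop \/ r = opnorm_on (wstar_closed_span es n) Sinv).

Definition Ks (e : nat -> X) (es : nat -> X -> R) : R := Rsup (Ks_set e es).

Definition infinite_set (A : nat -> bool) : Prop := forall m, exists k, (m <= k)%nat /\ A k = true.

Definition condC (e : nat -> X) (es : nat -> X -> R) : Prop :=
  forall (Lam : nat -> bool), infinite_set Lam -> forall theta, theta > 0 ->
  exists A : nat -> nat -> bool,
    (forall j k, A j k = true -> Lam k = true) /\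
    (forall j, infinite_set (A j)) /\
    (forall j1 j2 k, j1 <> j2 -> A j1 k = true -> A j2 k = false) /\
    forall xs : nat -> X -> R, (forall j, in_dual (xs j) /\ dnorm (xs j) <= 1) ->
      exists a : nat -> R,
        Un_cv (psum (fun j => Rabs (a j))) 1 /\
        (* G j = P_{A_j} x_j^* *)
        exists G : nat -> X -> R,
          (forall j, in_dual (G j) /\
             wstar_sum es (fun k => if A j k then xs j (e k) else 0) (G j)) /\
          exists g, in_dual g /\ wstar_sum G a g /\ dnorm g <= theta.

Definition dual_subspace (Y : (X -> R) -> Prop) : Prop :=
  (forall g, Y g -> in_dual g) /\ Y dzero /\
  (forall f g, Y f -> Y g -> Y (dadd f g)) /\ (forall c f, Y f -> Y (dscal c f)).

Definition iso_to_dual (Y : (X -> R) -> Prop) : Prop :=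
  exists J Jinv : (X -> R) -> (X -> R),
    bounded_op J /\ (forall f, in_dual f -> Y (J f)) /\
    (forall f, in_dual f -> Jinv (J f) = f) /\
    (forall g, Y g -> in_dual (Jinv g) /\ J (Jinv g) = g) /\
    (exists C, forall g, Y g -> dnorm (Jinv g) <= C * dnorm g).

Definition complemented (Y : (X -> R) -> Prop) : Prop :=
  exists P, bounded_op P /\ (forall f, in_dual f -> Y (P f)) /\ (forall g, Y g -> P g = g).

End Banach.

(* Main.v *)
Require Import Defs.
From Stdlib Require Import Reals List ClassicalEpsilon FunctionalExtensionality.
From Stdlib Require Import Lra Lia Classical.
Open Scope R_scope.

(* Since s_k^*(s_k) = 1, one of T and Id - T, call it H, satisfies |<H s_k^*, s_k>| >= 1/2 for
   infinitely many k.  Condition (C) says that a functional on S^* cannot be large on vectors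
   supported on each of the sets A_j; hence, for a given row functional f -> <H f, s_k>, one can
   pass to an infinite set of indices on whose closed span the row is arbitrarily small.  This
   disposes of the future columns although H is not weak*-continuous.  The past columns H s_k^*
   need not be null sequences, so each row n_i is replaced by the difference of the rows
   n_i < m_i, where m_i is chosen in a set on which the past columns are almost constant; by (C)
   again, the diagonal entry <H s_{n_i}^*, s_{m_i}> removed in this way can be made at most 1/8.
   With M the shift along (n_i), Q f = (<f, s_{n_i}> - <f, s_{m_i}>)_i and D the diagonal
   multiplier, D^{-1} Q H M is then within 1/2 of the identity and has a left inverse B by a
   Neumann series, and N = B D^{-1} Q. *)

(** * Suprema, finite sums and limits of real sequences *)

(** [Rsup] is an [epsilon] term, so it carries information only once nonemptiness and an upper bound
    are supplied; dual norms, operator norms and [Ks] all pass through this. *)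
Lemma Rsup_lub (E : R -> Prop) :
  (exists B, forall r, E r -> r <= B) -> (exists r, E r) -> is_lub E (Rsup E).
Proof.
  intros [B HB] Hne. unfold Rsup. apply epsilon_spec.
  destruct (completeness E) as [m Hm].
  - exists B. intros r Hr. now apply HB.
  - exact Hne.
  - now exists m.
Qed.

Lemma psum_le (a b : nat -> R) (N : nat) :
  (forall j, (j < N)%nat -> a j <= b j) -> psum a N <= psum b N.
Proof.
  induction N as [|N IH]; intros H; simpl; [lra|].
  apply Rplus_le_compat; [apply IH; intros|]; apply H; lia.
Qed.

Lemma psum_ext (a b : nat -> R) (N : nat) :
  (forall j, (j < N)%nat -> a j = b j) -> psum a N = psum b N.
Proof.
  induction N as [|N IH]; intros H; simpl; [easy|]. rewrite IH, H by auto. easy.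
Qed.

Lemma psum_scal (c : R) (a : nat -> R) (N : nat) : psum (fun j => c * a j) N = c * psum a N.
Proof. induction N as [|N IH]; simpl; [|rewrite IH]; ring. Qed.

Lemma psum_const (c : R) (N : nat) : psum (fun _ => c) N = INR N * c.
Proof. induction N as [|N IH]; [simpl; ring|]. rewrite S_INR. simpl. rewrite IH. ring. Qed.

Lemma psum_Rabs_le (a : nat -> R) (N : nat) : Rabs (psum a N) <= psum (fun j => Rabs (a j)) N.
Proof.
  induction N as [|N IH]; simpl; [rewrite Rabs_R0; lra|].
  eapply Rle_trans; [apply Rabs_triang|]. lra.
Qed.

Lemma Un_cv_const_eventually (u : nat -> R) (l : R) (N : nat) :
  (forall n, (N <= n)%nat -> u n = l) -> Un_cv u l.
Proof.
  intros H eps He. exists N. intros n Hn. rewrite H by lia.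
  unfold Rdist. now rewrite Rminus_diag, Rabs_R0.
Qed.

Lemma Un_cv_Rabs_le (u : nat -> R) (l B : R) (N : nat) :
  Un_cv u l -> (forall n, (N <= n)%nat -> Rabs (u n) <= B) -> Rabs l <= B.
Proof.
  intros Hu HB. apply Rnot_lt_le. intros Hlt.
  destruct (Hu (Rabs l - B)) as [n0 Hn0]; [lra|].
  specialize (Hn0 (max n0 N) ltac:(lia)). specialize (HB (max n0 N) ltac:(lia)).
  unfold Rdist in Hn0. rewrite Rabs_minus_sym in Hn0.
  pose proof (Rabs_triang_inv l (u (max n0 N))). lra.
Qed.

Lemma Un_cv_scal (c : R) (u : nat -> R) (l : R) : Un_cv u l -> Un_cv (fun n => c * u n) (c * l).
Proof.
  intros H. apply (CV_mult (fun _ => c) u c l); [|easy].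
  now apply Un_cv_const_eventually with O.
Qed.

Lemma Un_cv_ext (u v : nat -> R) (l : R) : (forall n, u n = v n) -> Un_cv u l -> Un_cv v l.
Proof. intros H. replace v with u; [easy|]. now extensionality n. Qed.

Lemma pow_half_pos (n : nat) : 0 < (/ 2) ^ n.
Proof. apply pow_lt. lra. Qed.

Lemma pow_half_small (c eps : R) : 0 < eps -> exists N, forall n, (N <= n)%nat -> c * (/ 2) ^ n < eps.
Proof.
  intros He. pose proof (Rabs_pos c). pose proof (Rle_abs c).
  destruct (pow_lt_1_zero (/ 2)) with (y := eps / (Rabs c + 1)) as [N HN].
  - rewrite Rabs_right; lra.
  - apply Rdiv_lt_0_compat; lra.
  - exists N. intros n Hn. specialize (HN n Hn). pose proof (pow_half_pos n) as Hp.
    rewrite Rabs_right in HN by lra.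
    apply Rmult_lt_compat_l with (r := Rabs c + 1) in HN; [|lra].
    replace ((Rabs c + 1) * (eps / (Rabs c + 1))) with eps in HN by (field; lra). nra.
Qed.

Lemma psum_geometric_le (r : nat -> R) (c : R) (N : nat) :
  (forall n, r n <= c * (/ 2) ^ n) -> 0 <= c -> psum r N <= 2 * c.
Proof.
  (* The remainder is kept in the bound so that the induction closes: adding c 2^-N to 2c - 2c 2^-N
     gives exactly 2c - 2c 2^-(N+1). *)
  intros Hr Hc. assert (H : psum r N <= 2 * c - 2 * c * (/ 2) ^ N).
  { induction N as [|N IH]; simpl; [lra|]. specialize (Hr N). lra. }
  pose proof (pow_half_pos N). nra.
Qed.

Lemma geometric_series (r : nat -> R) (c : R) : 0 <= c ->
  (forall n, Rabs (r n) <= c * (/ 2) ^ n) ->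
  exists l, Un_cv (psum r) l /\ forall N, Rabs (l - psum r N) <= 2 * c * (/ 2) ^ N.
Proof.
  intros Hc Hr.
  (* This bound is uniform in [n]: it gives the Cauchy property and, as [n] tends to infinity, the
     tail estimate. *)
  assert (Hd : forall N n, (N <= n)%nat -> Rabs (psum r n - psum r N) <= 2 * c * (/ 2) ^ N).
  { intros N n Hn.
    assert (H : Rabs (psum r n - psum r N) <= 2 * c * ((/ 2) ^ N - (/ 2) ^ n)).
    { induction Hn as [|n Hn IH].
      - rewrite !Rminus_diag, Rabs_R0. lra.
      - replace (psum r (S n) - psum r N) with ((psum r n - psum r N) + r n) by (simpl; ring).
        eapply Rle_trans; [apply Rabs_triang|]. specialize (Hr n). simpl. lra. }
    pose proof (pow_half_pos n). nra. }
  destruct (R_complete (psum r)) as [l Hl].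
  - intros eps He. destruct (pow_half_small (4 * c) eps He) as [N HN]. exists N.
    intros n m Hn Hm. unfold Rdist.
    replace (psum r n - psum r m) with ((psum r n - psum r N) + - (psum r m - psum r N)) by ring.
    eapply Rle_lt_trans; [apply Rabs_triang|]. rewrite Rabs_Ropp.
    specialize (HN N (Nat.le_refl N)).
    pose proof (Hd N n Hn). pose proof (Hd N m Hm). lra.
  - exists l. split; [easy|]. intros N.
    apply (Un_cv_Rabs_le (fun n => psum r n - psum r N) _ _ N); [|now apply Hd].
    apply CV_minus; [easy|]. now apply Un_cv_const_eventually with O.
Qed.

(** * The dual of a normed space *)

Section NormedSpaces.
Variable X : NormedSpace.

Lemma nv_add_cancel (x y : X) : nv_add x y = x -> y = nv_zero.
Proof.
  intros H.
  rewrite <- (nv_add0 _ y), (nv_addC _ y), <- (nv_addN _ x), (nv_addC _ x (nv_opp x)).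
  now rewrite <- nv_addA, H.
Qed.

Lemma nv_scal0l (x : X) : nv_scal 0 x = nv_zero.
Proof.
  apply nv_add_cancel with (nv_scal 0 x).
  rewrite <- nv_scalDl; now rewrite Rplus_0_l.
Qed.

Lemma nv_norm_ge0 (x : X) : 0 <= nv_norm x.
Proof.
  pose proof (nv_normD _ x (nv_scal (-1) x)) as H.
  replace (nv_add x (nv_scal (-1) x)) with (nv_scal 0 x) in H.
  - rewrite !nv_normZ, Rabs_R0, Rabs_left in H by lra. lra.
  - rewrite <- (nv_scal1 _ x) at 2. rewrite <- nv_scalDl. f_equal; ring.
Qed.

Lemma nv_norm_zero : nv_norm (@nv_zero X) = 0.
Proof. now rewrite <- (nv_scal0l nv_zero), nv_normZ, Rabs_R0, Rmult_0_l. Qed.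

Lemma dual_0 (f : X -> R) : in_dual X f -> f nv_zero = 0.
Proof. intros [[_ Hs] _]. rewrite <- (nv_scal0l nv_zero), Hs. ring. Qed.

Lemma dnorm_lub (f : X -> R) : in_dual X f ->
  is_lub (fun r => exists x, nv_norm x <= 1 /\ r = Rabs (f x)) (dnorm X f).
Proof.
  intros Hf. apply Rsup_lub.
  - destruct Hf as [_ [C HC]]. exists (Rabs C). intros r [x [Hx ->]].
    eapply Rle_trans; [apply HC|].
    pose proof (nv_norm_ge0 x). pose proof (Rle_abs C). pose proof (Rabs_pos C). nra.
  - exists (Rabs (f nv_zero)), nv_zero. rewrite nv_norm_zero. split; [lra|easy].
Qed.

Lemma dnorm_ge0 (f : X -> R) : in_dual X f -> 0 <= dnorm X f.
Proof.
  intros Hf. destruct (dnorm_lub f Hf) as [H _].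
  apply Rle_trans with (Rabs (f nv_zero)); [apply Rabs_pos|].
  apply H. exists nv_zero. rewrite nv_norm_zero. split; [lra|easy].
Qed.

Lemma dnorm_bound (f : X -> R) (x : X) : in_dual X f -> Rabs (f x) <= dnorm X f * nv_norm x.
Proof.
  intros Hf. destruct (nv_norm_ge0 x) as [Hx | Hx].
  - destruct (dnorm_lub f Hf) as [H _].
    assert (Hy : Rabs (f (nv_scal (/ nv_norm x) x)) <= dnorm X f).
    { apply H. exists (nv_scal (/ nv_norm x) x). split; [|easy].
      rewrite nv_normZ, Rabs_right.
      - right. field. lra.
      - left. now apply Rinv_0_lt_compat. }
    destruct Hf as [[_ Hs] _]. rewrite Hs, Rabs_mult, (Rabs_right (/ _)) in Hy
      by (left; now apply Rinv_0_lt_compat).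
    apply Rmult_le_reg_l with (/ nv_norm x); [now apply Rinv_0_lt_compat|].
    eapply Rle_trans; [exact Hy|]. right. field. lra.
  - symmetry in Hx. apply nv_norm_eq0 in Hx. subst.
    rewrite dual_0, nv_norm_zero, Rabs_R0 by easy. lra.
Qed.

Lemma dnorm_le (f : X -> R) (C : R) : in_dual X f -> 0 <= C ->
  (forall x, Rabs (f x) <= C * nv_norm x) -> dnorm X f <= C.
Proof.
  intros Hf HC H. apply (dnorm_lub f Hf). intros r [x [Hx ->]].
  eapply Rle_trans; [apply H|]. pose proof (nv_norm_ge0 x). nra.
Qed.

Lemma in_dual_add (f g : X -> R) : in_dual X f -> in_dual X g -> in_dual X (dadd X f g).
Proof.
  intros [[Fa Fs] [C HC]] [[Ga Gs] [D HD]]. unfold dadd. repeat split.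
  - intros. rewrite Fa, Ga. ring.
  - intros. rewrite Fs, Gs. ring.
  - exists (C + D). intros x. eapply Rle_trans; [apply Rabs_triang|].
    specialize (HC x). specialize (HD x). lra.
Qed.

Lemma in_dual_scal (c : R) (f : X -> R) : in_dual X f -> in_dual X (dscal X c f).
Proof.
  intros [[Fa Fs] [C HC]]. unfold dscal. repeat split.
  - intros. rewrite Fa. ring.
  - intros. rewrite Fs. ring.
  - exists (Rabs c * C). intros x. rewrite Rabs_mult, Rmult_assoc.
    apply Rmult_le_compat_l; [apply Rabs_pos|apply HC].
Qed.

Lemma dsub_E (f g : X -> R) : dsub X f g = dadd X f (dscal X (-1) g).
Proof. extensionality x. unfold dsub, dadd, dscal. ring. Qed.

Lemma in_dual_sub (f g : X -> R) : in_dual X f -> in_dual X g -> in_dual X (dsub X f g).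
Proof. intros. rewrite dsub_E. apply in_dual_add; [easy|now apply in_dual_scal]. Qed.

Lemma in_dual_zero : in_dual X (dzero X).
Proof.
  unfold dzero. repeat split; intros; try ring.
  exists 0. intros. rewrite Rabs_R0. lra.
Qed.

Lemma dnorm_add (f g : X -> R) : in_dual X f -> in_dual X g ->
  dnorm X (dadd X f g) <= dnorm X f + dnorm X g.
Proof.
  intros Hf Hg. apply dnorm_le.
  - now apply in_dual_add.
  - pose proof (dnorm_ge0 f Hf). pose proof (dnorm_ge0 g Hg). lra.
  - intros x. unfold dadd. eapply Rle_trans; [apply Rabs_triang|].
    pose proof (dnorm_bound f x Hf). pose proof (dnorm_bound g x Hg). lra.
Qed.

Lemma dnorm_scal_le (c : R) (f : X -> R) : in_dual X f ->
  dnorm X (dscal X c f) <= Rabs c * dnorm X f.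
Proof.
  intros Hf. apply dnorm_le.
  - now apply in_dual_scal.
  - apply Rmult_le_pos; [apply Rabs_pos|now apply dnorm_ge0].
  - intros x. unfold dscal. rewrite Rabs_mult, Rmult_assoc.
    apply Rmult_le_compat_l; [apply Rabs_pos|now apply dnorm_bound].
Qed.

Lemma dnorm_sub (f g : X -> R) : in_dual X f -> in_dual X g ->
  dnorm X (dsub X f g) <= dnorm X f + dnorm X g.
Proof.
  intros Hf Hg. rewrite dsub_E.
  eapply Rle_trans; [apply dnorm_add; [easy|now apply in_dual_scal]|].
  pose proof (dnorm_scal_le (-1) g Hg) as H. rewrite Rabs_left in H by lra. lra.
Qed.

Lemma dnorm_zero : dnorm X (dzero X) = 0.
Proof.
  apply Rle_antisym; [|apply dnorm_ge0, in_dual_zero].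
  apply dnorm_le; [apply in_dual_zero|lra|].
  intros. unfold dzero. rewrite Rabs_R0. lra.
Qed.

Lemma dnorm_eq0 (f : X -> R) : in_dual X f -> dnorm X f <= 0 -> f = dzero X.
Proof.
  intros Hf H. extensionality x. pose proof (dnorm_bound f x Hf) as Hb.
  pose proof (nv_norm_ge0 x). pose proof (dnorm_ge0 f Hf).
  replace (dnorm X f) with 0 in Hb by lra. rewrite Rmult_0_l in Hb.
  unfold dzero. destruct (Req_dec (f x) 0) as [|Hn]; [easy|].
  pose proof (Rabs_pos_lt _ Hn). lra.
Qed.

Definition dsum (F : nat -> X -> R) (N : nat) : X -> R := fun x => psum (fun j => F j x) N.

Lemma dsum_S (F : nat -> X -> R) (N : nat) : dsum F (S N) = dadd X (dsum F N) (F N).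
Proof. reflexivity. Qed.

Lemma in_dual_sum (F : nat -> X -> R) (N : nat) :
  (forall j, (j < N)%nat -> in_dual X (F j)) -> in_dual X (dsum F N).
Proof.
  induction N as [|N IH]; intros H; [apply in_dual_zero|].
  rewrite dsum_S. apply in_dual_add; [|apply H; lia]. apply IH. intros; apply H; lia.
Qed.

Lemma dnorm_sum (F : nat -> X -> R) (N : nat) :
  (forall j, (j < N)%nat -> in_dual X (F j)) ->
  dnorm X (dsum F N) <= psum (fun j => dnorm X (F j)) N.
Proof.
  induction N as [|N IH]; intros H.
  - change (dsum F 0) with (dzero X). rewrite dnorm_zero. simpl. lra.
  - rewrite dsum_S. simpl. eapply Rle_trans; [apply dnorm_add|].
    + apply in_dual_sum; intros; apply H; lia.
    + apply H; lia.
    + apply Rplus_le_compat_r, IH. intros; apply H; lia.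
Qed.

Lemma bounded_op_sub (T : (X -> R) -> X -> R) (f g : X -> R) :
  bounded_op X T -> in_dual X f -> in_dual X g -> T (dsub X f g) = dsub X (T f) (T g).
Proof.
  intros (_ & Ta & Ts & _) Hf Hg.
  rewrite !dsub_E, Ta, Ts; try easy. now apply in_dual_scal.
Qed.

Lemma bounded_op_zero (T : (X -> R) -> X -> R) : bounded_op X T -> T (dzero X) = dzero X.
Proof.
  intros (_ & _ & Ts & _).
  replace (dzero X) with (dscal X 0 (dzero X)) at 1.
  - rewrite Ts by apply in_dual_zero. extensionality x. unfold dscal, dzero. ring.
  - extensionality x. unfold dscal, dzero. ring.
Qed.

Lemma bounded_op_const (T : (X -> R) -> X -> R) : bounded_op X T ->
  exists K, 0 <= K /\ forall f, in_dual X f -> dnorm X (T f) <= K * dnorm X f.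
Proof.
  intros (_ & _ & _ & [C HC]). exists (Rabs C). split; [apply Rabs_pos|].
  intros f Hf. eapply Rle_trans; [now apply HC|].
  apply Rmult_le_compat_r; [now apply dnorm_ge0|apply Rle_abs].
Qed.

Lemma bounded_op_comp (T U : (X -> R) -> X -> R) :
  bounded_op X T -> bounded_op X U -> bounded_op X (fun f => T (U f)).
Proof.
  intros HT HU. destruct (bounded_op_const T HT) as [K [HK0 HK]].
  destruct (bounded_op_const U HU) as [L [HL0 HL]].
  destruct HT as (Td & Ta & Ts & _). destruct HU as (Ud & Ua & Us & _).
  split; [|split; [|split]]; intros.
  - auto.
  - rewrite Ua, Ta; auto.
  - rewrite Us, Ts; auto.
  - exists (K * L). intros f Hf. eapply Rle_trans; [now apply HK, Ud|].
    rewrite Rmult_assoc. apply Rmult_le_compat_l; auto.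
Qed.

Lemma bounded_op_id_minus (T : (X -> R) -> X -> R) :
  bounded_op X T -> bounded_op X (fun f => dsub X f (T f)).
Proof.
  intros (Td & Ta & Ts & [C HC]). split; [|split; [|split]].
  - intros. apply in_dual_sub; auto.
  - intros. rewrite Ta by easy. extensionality x. unfold dsub, dadd. ring.
  - intros. rewrite Ts by easy. extensionality x. unfold dsub, dscal. ring.
  - exists (1 + C). intros f Hf. eapply Rle_trans; [apply dnorm_sub; auto|].
    specialize (HC f Hf). lra.
Qed.

(** The lower bound 0 is recorded as well, because the product of two operator norms is later
    estimated factor by factor. *)
Lemma opnorm_le (T : (X -> R) -> X -> R) (C : R) : bounded_op X T -> 0 <= C ->
  (forall f, in_dual X f -> dnorm X (T f) <= C * dnorm X f) -> 0 <= opnorm X T <= C.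
Proof.
  intros HT HC H.
  assert (HB : forall r, (exists f, in_dual X f /\ dnorm X f <= 1 /\ r = dnorm X (T f)) -> r <= C).
  { intros r (f & Hf & Hf1 & ->). eapply Rle_trans; [now apply H|].
    pose proof (dnorm_ge0 f Hf). nra. }
  assert (H0 : exists f, in_dual X f /\ dnorm X f <= 1 /\ 0 = dnorm X (T f)).
  { exists (dzero X). rewrite bounded_op_zero, dnorm_zero by easy.
    repeat split; try lra; apply in_dual_zero. }
  destruct (Rsup_lub (fun r => exists f, in_dual X f /\ dnorm X f <= 1 /\ r = dnorm X (T f)))
    as [Hu Hl]; [now exists C|now exists 0|].
  split; [now apply Hu|now apply Hl].
Qed.

(** Stated relative to a set [P] so as to serve both a shift on the whole dual and its inverse on a
    weak* closed span. Closure under scaling lets [f] be normalized; the constant [C] makes the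
    supremum finite and settles the case of norm 0. *)
Lemma opnorm_on_bound (P : (X -> R) -> Prop) (T : (X -> R) -> X -> R) (f : X -> R) :
  (forall g, P g -> in_dual X g /\ in_dual X (T g)) ->
  (forall c g, P g -> P (dscal X c g) /\ T (dscal X c g) = dscal X c (T g)) ->
  (exists C, forall g, P g -> dnorm X (T g) <= C * dnorm X g) ->
  P f -> dnorm X (T f) <= opnorm_on X P T * dnorm X f.
Proof.
  intros Hd Hs [C HC] Pf. destruct (Hd f Pf) as [Df DTf].
  destruct (Rsup_lub (fun r => exists f, P f /\ dnorm X f <= 1 /\ r = dnorm X (T f))) as [Hu _].
  - exists (Rabs C). intros r (g & Pg & Hg & ->). eapply Rle_trans; [now apply HC|].
    pose proof (dnorm_ge0 g (proj1 (Hd g Pg))). pose proof (Rle_abs C). pose proof (Rabs_pos C). nra.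
  - exists (dnorm X (T (dscal X 0 f))), (dscal X 0 f). split; [now apply Hs|split; [|easy]].
    pose proof (dnorm_scal_le 0 f Df). rewrite Rabs_R0 in H. lra.
  - destruct (dnorm_ge0 f Df) as [Hpos|H0].
    + set (c := / dnorm X f).
      assert (Hc : 0 < c) by now apply Rinv_0_lt_compat.
      assert (E : dnorm X (dscal X c (T f)) <= opnorm_on X P T).
      { rewrite <- (proj2 (Hs c f Pf)). apply Hu. exists (dscal X c f).
        split; [now apply Hs|split; [|easy]].
        eapply Rle_trans; [now apply dnorm_scal_le|].
        rewrite Rabs_right by lra. right. unfold c. field. lra. }
      assert (E2 : dnorm X (T f) <= dnorm X f * dnorm X (dscal X c (T f))).
      { replace (T f) with (dscal X (dnorm X f) (dscal X c (T f))) at 1.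
        - eapply Rle_trans; [apply dnorm_scal_le; now apply in_dual_scal|].
          rewrite Rabs_right by lra. lra.
        - extensionality x. unfold dscal, c. field. lra. }
      rewrite Rmult_comm. eapply Rle_trans; [exact E2|].
      apply Rmult_le_compat_l; lra.
    + specialize (HC f Pf). rewrite <- H0, Rmult_0_r in *. exact HC.
Qed.

End NormedSpaces.

(** * Neumann series on the dual space *)

Section Neumann.
Variable X : NormedSpace.

(** The values at each [x] converge with an error proportional to [nv_norm x], so the pointwise
    limit is linear by uniqueness of limits, is bounded, and is approximated in norm. *)
Lemma dual_geometric_series (r : nat -> X -> R) (c : R) : 0 <= c ->
  (forall n, in_dual X (r n)) -> (forall n, dnorm X (r n) <= c * (/ 2) ^ n) ->
  exists f, in_dual X f /\ forall N, dnorm X (dsub X f (dsum X r N)) <= 2 * c * (/ 2) ^ N.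
Proof.
  intros Hc Dr Hr.
  assert (Hx : forall x : X, exists l, Un_cv (psum (fun j => r j x)) l /\
     forall N, Rabs (l - psum (fun j => r j x) N) <= 2 * (c * nv_norm x) * (/ 2) ^ N).
  { intros x. pose proof (nv_norm_ge0 X x) as Hn. apply geometric_series; [now apply Rmult_le_pos|].
    intros n. eapply Rle_trans; [apply dnorm_bound, Dr|].
    specialize (Hr n). nra. }
  set (f := fun x => epsilon (inhabits 0) (fun l => Un_cv (psum (fun j => r j x)) l /\
     forall N, Rabs (l - psum (fun j => r j x) N) <= 2 * (c * nv_norm x) * (/ 2) ^ N)).
  assert (Hf : forall x, Un_cv (psum (fun j => r j x)) (f x) /\
     forall N, Rabs (f x - psum (fun j => r j x) N) <= 2 * (c * nv_norm x) * (/ 2) ^ N).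
  { intros x. unfold f. apply epsilon_spec, Hx. }
  assert (Ds : forall N, in_dual X (dsum X r N)) by (intros; apply in_dual_sum; auto).
  assert (Df : in_dual X f).
  { repeat split.
    - intros x y. apply UL_sequence with (psum (fun j => r j (nv_add x y))); [apply Hf|].
      eapply Un_cv_ext; [|apply CV_plus; [apply (Hf x)|apply (Hf y)]].
      intros n. symmetry. apply (proj1 (proj1 (Ds n))).
    - intros a x. apply UL_sequence with (psum (fun j => r j (nv_scal a x))); [apply Hf|].
      eapply Un_cv_ext; [|apply Un_cv_scal, (Hf x)].
      intros n. symmetry. apply (proj2 (proj1 (Ds n))).
    - exists (2 * c). intros x. pose proof (proj2 (Hf x) O) as H. simpl in H.
      rewrite Rminus_0_r in H. lra. }
  exists f. split; [easy|]. intros N. apply dnorm_le.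
  - now apply in_dual_sub.
  - pose proof (pow_half_pos N). nra.
  - intros x. unfold dsub, dsum. eapply Rle_trans; [apply Hf|]. lra.
Qed.

(** The hypothesis makes [A] bounded below by 1/2, hence injective, and the Neumann series makes it
    onto. [B] is the inverse on the dual, of norm at most 2 by the lower bound. *)
Lemma near_identity_left_inverse (A : (X -> R) -> X -> R) : bounded_op X A ->
  (forall f, in_dual X f -> dnorm X (dsub X f (A f)) <= / 2 * dnorm X f) ->
  exists B, bounded_op X B /\ (forall f, in_dual X f -> B (A f) = f) /\
    forall g, in_dual X g -> dnorm X (B g) <= 2 * dnorm X g.
Proof.
  intros HA Hq.
  pose proof (bounded_op_id_minus X A HA) as HE.
  destruct (bounded_op_const X A HA) as [K [HK0 HK]].
  assert (Hlow : forall f, in_dual X f -> dnorm X f <= 2 * dnorm X (A f)).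
  { intros f Df. pose proof (Hq f Df).
    assert (dnorm X f <= dnorm X (dsub X f (A f)) + dnorm X (A f)); [|lra].
    replace f with (dadd X (dsub X f (A f)) (A f)) at 1
      by (extensionality x; unfold dadd, dsub; ring).
    apply dnorm_add; [now apply HE|now apply HA]. }
  assert (Hinj : forall f h, in_dual X f -> in_dual X h -> A f = A h -> f = h).
  { intros f h Df Dh E.
    assert (E0 : dsub X f h = dzero X).
    { apply dnorm_eq0; [now apply in_dual_sub|].
      eapply Rle_trans; [apply Hlow; now apply in_dual_sub|].
      rewrite bounded_op_sub, E by easy.
      replace (dsub X (A h) (A h)) with (dzero X)
        by (extensionality x; unfold dsub, dzero; ring).
      rewrite dnorm_zero. lra. }
    extensionality x. apply (f_equal (fun k => k x)) in E0. unfold dsub, dzero in E0. lra. }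
  assert (Hsurj : forall g, in_dual X g -> exists f, in_dual X f /\ A f = g).
  { intros g Dg.
    (* [r n] is (I - A)^n g; by telescoping, the partial sums s_N satisfy g - A s_N = r_N. *)
    set (r := fun n => Nat.iter n (fun f => dsub X f (A f)) g).
    assert (Dr : forall n, in_dual X (r n)).
    { induction n as [|n IH]; [easy|]. now apply HE. }
    assert (Hr : forall n, dnorm X (r n) <= dnorm X g * (/ 2) ^ n).
    { induction n as [|n IH]; [simpl; lra|].
      eapply Rle_trans; [apply (Hq (r n)), Dr|]. simpl. lra. }
    assert (Ds : forall N, in_dual X (dsum X r N)) by (intros; apply in_dual_sum; auto).
    assert (HAs : forall N, dsub X g (A (dsum X r N)) = r N).
    { induction N as [|N IH].
      - change (dsum X r 0) with (dzero X). rewrite bounded_op_zero by easy.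
        extensionality x. unfold dsub, dzero. simpl. ring.
      - rewrite dsum_S, (proj1 (proj2 HA)) by auto.
        change (r (S N)) with (dsub X (r N) (A (r N))).
        extensionality x. apply (f_equal (fun k => k x)) in IH. unfold dsub, dadd in *. lra. }
    destruct (dual_geometric_series r (dnorm X g) (dnorm_ge0 X g Dg) Dr Hr) as [f [Df Hf]].
    exists f. split; [easy|].
    assert (DAf : in_dual X (A f)) by now apply HA.
    assert (E0 : dsub X (A f) g = dzero X).
    { apply dnorm_eq0; [now apply in_dual_sub|].
      apply Rnot_lt_le. intros Hpos.
      (* The tail of the series has norm at most 2 2^-N times that of [g], and [A] multiplies this
         by at most [K]; the remainder [r N] accounts for the 1. *)
      destruct (pow_half_small ((2 * K + 1) * dnorm X g) _ Hpos) as [N HN].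
      specialize (HN N (Nat.le_refl N)). apply (Rlt_irrefl (dnorm X (dsub X (A f) g))).
      eapply Rle_lt_trans; [|exact HN].
      replace (dsub X (A f) g) with (dsub X (A (dsub X f (dsum X r N))) (r N)).
      - eapply Rle_trans; [apply dnorm_sub; [apply HA; now apply in_dual_sub|easy]|].
        specialize (Hf N). specialize (Hr N).
        pose proof (HK (dsub X f (dsum X r N)) ltac:(now apply in_dual_sub)). nra.
      - rewrite bounded_op_sub by easy. extensionality x.
        pose proof (f_equal (fun k => k x) (HAs N)) as E. unfold dsub in *. lra. }
    extensionality x. apply (f_equal (fun k => k x)) in E0. unfold dsub, dzero in E0. lra. }
  (* Preimages are chosen by [epsilon], with [g] as a mere witness of inhabitation. Linearity of [B]
     follows from that of [A] and injectivity. *)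
  set (B := fun g => epsilon (inhabits g) (fun f => in_dual X f /\ A f = g)).
  assert (HB : forall g, in_dual X g -> in_dual X (B g) /\ A (B g) = g).
  { intros g Dg. apply (epsilon_spec (inhabits g) (fun f => in_dual X f /\ A f = g)). auto. }
  assert (HBA : forall f, in_dual X f -> B (A f) = f).
  { intros f Df. destruct (HB (A f)); [now apply HA|]. apply Hinj; easy. }
  assert (HB2 : forall g, in_dual X g -> dnorm X (B g) <= 2 * dnorm X g).
  { intros g Dg. destruct (HB g Dg) as [DB E]. rewrite <- E at 2. now apply Hlow. }
  exists B. split; [|easy]. split; [intros; now apply HB|]. split; [|split; [|now exists 2]].
  - intros g h Dg Dh. destruct (HB g Dg) as [DBg Eg]. destruct (HB h Dh) as [DBh Eh].
    rewrite <- Eg, <- Eh at 1. rewrite <- (proj1 (proj2 HA)) by easy.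
    apply HBA. now apply in_dual_add.
  - intros c g Dg. destruct (HB g Dg) as [DBg Eg].
    rewrite <- Eg at 1. rewrite <- (proj1 (proj2 (proj2 HA))) by easy.
    apply HBA. now apply in_dual_scal.
Qed.

End Neumann.

(** * Weak* Schauder bases *)

Section WeakStarBasis.
Variables (X : NormedSpace) (e : nat -> X) (es : nat -> X -> R).
Hypothesis e_norm : forall j, nv_norm (e j) = 1.
Hypothesis es_coord : coord_functionals X e es.
Hypothesis es_norm : forall j, dnorm X (es j) = 1.
Hypothesis es_basis : wstar_basis X e es.

Lemma es_dual (j : nat) : in_dual X (es j).
Proof. apply es_coord. Qed.

Lemma es_e (j i : nat) : es j (e i) = if Nat.eqb i j then 1 else 0.
Proof. apply es_coord. Qed.

Lemma coord_le (f : X -> R) (j : nat) : in_dual X f -> Rabs (f (e j)) <= dnorm X f.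
Proof. intros Hf. pose proof (dnorm_bound X f (e j) Hf) as H. rewrite e_norm in H. lra. Qed.

(** Both functionals are the weak* sums of their coordinates. Identities in the dual can thus be
    checked coordinate by coordinate. *)
Lemma dual_ext (f g : X -> R) : in_dual X f -> in_dual X g ->
  (forall j, f (e j) = g (e j)) -> f = g.
Proof.
  intros Hf Hg H. extensionality x. apply UL_sequence with (1 := es_basis f Hf x).
  eapply Un_cv_ext; [|apply (es_basis g Hg x)].
  intros n. apply psum_ext. intros j _. now rewrite H.
Qed.

Lemma psum_delta (n : nat -> nat) (a : nat -> R) (i N : nat) :
  (forall j, n j = n i -> j = i) ->
  psum (fun j => a j * es (n j) (e (n i))) N = if Nat.ltb i N then a i else 0.
Proof.
  intros Hn. induction N as [|N IH]; [easy|]. simpl psum. rewrite IH, es_e.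
  destruct (Nat.eqb_spec (n i) (n N)) as [E|E].
  - symmetry in E. apply Hn in E. subst N. rewrite Nat.ltb_irrefl, (proj2 (Nat.ltb_lt i (S i))) by lia. ring.
  - destruct (Nat.ltb_spec i N), (Nat.ltb_spec i (S N)); try lia; try ring.
    assert (N = i) by lia. subst. easy.
Qed.

Lemma psum_off_range (n : nat -> nat) (a : nat -> R) (k N : nat) :
  (forall j, n j <> k) -> psum (fun j => a j * es (n j) (e k)) N = 0.
Proof.
  intros Hn. induction N as [|N IH]; simpl; [easy|]. rewrite IH, es_e.
  destruct (Nat.eqb_spec k (n N)) as [E|E]; [now destruct (Hn N)|ring].
Qed.

Lemma wstar_sum_sub_coord (n : nat -> nat) (a : nat -> R) (g : X -> R) (i : nat) :
  (forall j, n j = n i -> j = i) -> wstar_sum X (fun j => es (n j)) a g -> g (e (n i)) = a i.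
Proof.
  intros Hn Hg. eapply UL_sequence; [apply Hg|].
  apply Un_cv_const_eventually with (S i). intros N HN.
  rewrite psum_delta by easy. now rewrite (proj2 (Nat.ltb_lt i N)) by lia.
Qed.

Lemma wstar_sum_off_range (n : nat -> nat) (a : nat -> R) (g : X -> R) (k : nat) :
  (forall j, n j <> k) -> wstar_sum X (fun j => es (n j)) a g -> g (e k) = 0.
Proof.
  intros Hn Hg. eapply UL_sequence; [apply Hg|].
  apply Un_cv_const_eventually with O. intros N _. now apply psum_off_range.
Qed.

Lemma wstar_sum_coord (a : nat -> R) (g : X -> R) (i : nat) :
  wstar_sum X es a g -> g (e i) = a i.
Proof. apply (wstar_sum_sub_coord (fun j => j)). easy. Qed.

(** Each [es j] has norm 1, so the weak* expansion of [g] is dominated by a geometric series. This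
    turns estimates of single rows into a norm estimate. *)
Lemma dnorm_le_l1 (g : X -> R) (c : R) : in_dual X g -> 0 <= c ->
  (forall j, Rabs (g (e j)) <= c * (/ 2) ^ j) -> dnorm X g <= 2 * c.
Proof.
  intros Hg Hc H. apply dnorm_le; [easy|lra|]. intros x.
  apply Un_cv_Rabs_le with (N := O) (1 := es_basis g Hg x). intros n _.
  eapply Rle_trans; [apply psum_Rabs_le|].
  pose proof (nv_norm_ge0 X x) as Hx. rewrite Rmult_assoc.
  apply psum_geometric_le; [|now apply Rmult_le_pos]. intros j. rewrite Rabs_mult.
  pose proof (dnorm_bound X (es j) x (es_dual j)) as Hb. rewrite es_norm in Hb.
  replace (c * nv_norm x * (/ 2) ^ j) with (c * (/ 2) ^ j * (1 * nv_norm x)) by ring.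
  apply Rmult_le_compat; auto using Rabs_pos.
Qed.

(** * Unconditional bases: multipliers and operators given by coordinates *)

Section Unconditional.
Hypothesis es_unc : unconditional X es.

(** The infimum is minus the supremum of the negated set, which -1 bounds because admissible
    constants are at least 1. *)
Lemma Ku_glb : is_glb (unc_const X es) (Ku X es).
Proof.
  unfold Ku, Rinf. apply epsilon_spec.
  destruct (completeness (fun r => unc_const X es (- r))) as [m [Hm1 Hm2]].
  - exists (-1). intros r [H _]. lra.
  - destruct es_unc as [C HC]. exists (- C). now rewrite Ropp_involutive.
  - exists (- m). split.
    + intros x Hx. rewrite <- (Ropp_involutive x) in Hx. apply Hm1 in Hx. lra.
    + intros b Hb. assert (m <= - b); [|lra]. apply Hm2. intros r Hr. apply Hb in Hr. lra.
Qed.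

Lemma Ku_ge1 : 1 <= Ku X es.
Proof. apply Ku_glb. now intros x [H _]. Qed.

Lemma linf_norm_bound (gam : nat -> R) (B : R) :
  (forall j, Rabs (gam j) <= B) -> 0 <= linf_norm gam <= B.
Proof.
  intros HB. destruct (Rsup_lub (fun r => exists j, r = Rabs (gam j))) as [Hu Hl].
  - exists B. intros r [j ->]. apply HB.
  - now exists (Rabs (gam O)), O.
  - split.
    + apply Rle_trans with (Rabs (gam O)); [apply Rabs_pos|]. apply Hu. now exists O.
    + apply Hl. intros r [j ->]. apply HB.
Qed.

(** Each admissible constant yields some [g], and coordinates determine it; so one [g] obeys the
    bounds for all constants, hence the bound for their infimum. *)
Lemma multiplier (gam : nat -> R) (B : R) (f : X -> R) :
  (forall j, Rabs (gam j) <= B) -> in_dual X f ->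
  exists g, in_dual X g /\ (forall j, g (e j) = gam j * f (e j)) /\
    dnorm X g <= Ku X es * B * dnorm X f.
Proof.
  intros HB Hf.
  assert (HC : forall C, unc_const X es C -> exists g, in_dual X g /\
     (forall j, g (e j) = gam j * f (e j)) /\ dnorm X g <= C * B * dnorm X f).
  { intros C [HC1 HC]. destruct (HC gam (fun j => f (e j)) f) as (g & Hg & Hs & Hn).
    - now exists B.
    - easy.
    - now apply es_basis.
    - exists g. split; [easy|split].
      + intros j. now rewrite (wstar_sum_coord _ g j Hs).
      + pose proof (linf_norm_bound gam B HB). pose proof (dnorm_ge0 X f Hf).
        eapply Rle_trans; [exact Hn|]. apply Rmult_le_compat_r; [easy|].
        apply Rmult_le_compat_l; lra. }
  destruct es_unc as [C0 HC0]. destruct (HC C0 HC0) as (g & Hg & Hc & _).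
  exists g. split; [easy|split; [easy|]].
  assert (Hall : forall C, unc_const X es C -> dnorm X g <= C * B * dnorm X f).
  { intros C HuC. destruct (HC C HuC) as (h & Hh & Hch & Hn).
    replace g with h; [easy|]. apply dual_ext; try easy. intros. now rewrite Hc, Hch. }
  assert (HB0 : 0 <= B) by (apply Rle_trans with (1 := Rabs_pos (gam O)); apply HB).
  pose proof (dnorm_ge0 X f Hf). set (b := B * dnorm X f).
  assert (Hb0 : 0 <= b) by now apply Rmult_le_pos.
  (* Passing to the infimum requires division by [b]; if [b] is 0, a single admissible constant
     already forces [g] to have norm 0. *)
  rewrite Rmult_assoc. fold b. destruct Hb0 as [Hb0|Hb0].
  - apply Rmult_le_reg_r with (/ b); [now apply Rinv_0_lt_compat|].
    replace (Ku X es * b * / b) with (Ku X es) by (field; lra).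
    apply Ku_glb. intros C HuC. specialize (Hall C HuC).
    rewrite Rmult_assoc in Hall. fold b in Hall.
    apply Rmult_le_reg_r with b; [easy|].
    replace (dnorm X g * / b * b) with (dnorm X g) by (field; lra). easy.
  - specialize (Hall C0 HC0). rewrite Rmult_assoc in Hall. fold b in Hall.
    rewrite <- Hb0 in *. lra.
Qed.

(* Linearity is automatic: by [dual_ext] a functional is determined by its coordinates. *)
Lemma coord_operator (n : nat -> nat) (c : nat -> R) (K : R) :
  (forall f, in_dual X f -> exists g, in_dual X g /\ (forall j, g (e j) = c j * f (e (n j))) /\
     dnorm X g <= K * dnorm X f) ->
  exists T, bounded_op X T /\ (forall f, in_dual X f -> forall j, T f (e j) = c j * f (e (n j))) /\
    forall f, in_dual X f -> dnorm X (T f) <= K * dnorm X f.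
Proof.
  intros H.
  set (T := fun f => epsilon (inhabits f) (fun g => in_dual X g /\
     (forall j, g (e j) = c j * f (e (n j))) /\ dnorm X g <= K * dnorm X f)).
  assert (HT : forall f, in_dual X f -> in_dual X (T f) /\
     (forall j, T f (e j) = c j * f (e (n j))) /\ dnorm X (T f) <= K * dnorm X f).
  { intros f Hf. unfold T. apply epsilon_spec. auto. }
  exists T. split; [|split; intros; now apply HT].
  split; [intros; now apply HT|]. split; [|split].
  - intros f g Hf Hg. destruct (HT f Hf) as (D1 & C1 & _). destruct (HT g Hg) as (D2 & C2 & _).
    destruct (HT (dadd X f g)) as (D3 & C3 & _); [now apply in_dual_add|].
    apply dual_ext; [easy|now apply in_dual_add|]. intros j.
    unfold dadd in *. rewrite C1, C2, C3. ring.
  - intros a f Hf. destruct (HT f Hf) as (D1 & C1 & _).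
    destruct (HT (dscal X a f)) as (D3 & C3 & _); [now apply in_dual_scal|].
    apply dual_ext; [easy|now apply in_dual_scal|]. intros j.
    unfold dscal in *. rewrite C1, C3. ring.
  - exists K. intros f Hf. now apply HT.
Qed.

(** * Subsymmetric bases: shifts along subsequences and their inverses *)

Section Subsymmetric.
Hypothesis es_subsym : subsymmetric X e es.
Hypothesis Ks_bounded : exists B, forall r, Ks_set X e es r -> r <= B.

Lemma strictly_incr_lt (n : nat -> nat) (i j : nat) :
  strictly_incr n -> (i < j)%nat -> (n i < n j)%nat.
Proof. intros Hn. induction 1 as [|j _ IH]; [apply Hn|]. specialize (Hn j). lia. Qed.

Lemma strictly_incr_inj (n : nat -> nat) (i j : nat) : strictly_incr n -> n j = n i -> j = i.
Proof.
  intros Hn E. destruct (Nat.lt_trichotomy j i) as [L|[L|L]]; [|easy|];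
  apply (strictly_incr_lt n _ _ Hn) in L; lia.
Qed.

Lemma wstar_closed_span_scal (n : nat -> nat) (c : R) (g : X -> R) :
  wstar_closed_span X es n g -> wstar_closed_span X es n (dscal X c g).
Proof.
  intros [Dg Hg]. split; [now apply in_dual_scal|]. intros xs eps He.
  pose proof (Rabs_pos c) as Hc0.
  (* Dividing by |c| + 1 instead of |c| covers the case c = 0. *)
  destruct (Hg xs (eps / (Rabs c + 1))) as (h & (N & a & Ha) & Hh).
  { apply Rdiv_lt_0_compat; lra. }
  exists (dscal X c h). split.
  - exists N, (fun j => c * a j). intros x. unfold dscal. rewrite Ha, <- psum_scal.
    apply psum_ext. intros. ring.
  - intros x Hx. specialize (Hh x Hx). unfold dscal.
    replace (c * h x - c * g x) with (c * (h x - g x)) by ring. rewrite Rabs_mult.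
    apply Rmult_lt_compat_l with (r := Rabs c + 1) in Hh; [|lra].
    replace ((Rabs c + 1) * (eps / (Rabs c + 1))) with eps in Hh by (field; lra).
    pose proof (Rabs_pos (h x - g x)). nra.
Qed.

(** The gaps between consecutive values of [n] contribute nothing; the index [n N] is excluded on
    the left just as [N] is on the right. *)
Lemma psum_subsequence (n : nat -> nat) (h : nat -> R) (N : nat) : strictly_incr n ->
  (forall k, (forall j, n j <> k) -> h k = 0) ->
  psum h (n N) = psum (fun j => h (n j)) N.
Proof.
  intros Hn Hh.
  assert (Hz : forall a b, (a <= b)%nat -> (forall k, (a <= k < b)%nat -> h k = 0) ->
    psum h b = psum h a).
  { intros a b Hab. induction Hab as [|b Hab IH]; intros Hk; [easy|].
    simpl. rewrite IH, (Hk b) by (intros; try apply Hk; lia). ring. }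
  induction N as [|N IH]; simpl.
  - apply (Hz O); [lia|]. intros k Hk. apply Hh. intros [|j] E; [lia|].
    pose proof (strictly_incr_lt n 0 (S j) Hn ltac:(lia)). lia.
  - rewrite <- IH. change (psum h (n N) + h (n N)) with (psum h (S (n N))).
    apply Hz; [apply Hn|]. intros k Hk. apply Hh. intros j E. subst k.
    destruct (Nat.lt_trichotomy j N) as [L|[L|L]].
    + apply (strictly_incr_lt n _ _ Hn) in L. lia.
    + subst. lia.
    + destruct (Nat.eq_dec j (S N)) as [->|]; [lia|].
      pose proof (strictly_incr_lt n (S N) j Hn ltac:(lia)). lia.
Qed.

(** A basic weak* neighbourhood tests only finitely many vectors, so one index serves them all. *)
Lemma Un_cv_common_index (u : X -> nat -> R) (l : X -> R) (xs : list X) (eps : R) : eps > 0 ->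
  (forall x, Un_cv (u x) (l x)) ->
  exists N, forall n x, (N <= n)%nat -> In x xs -> Rabs (u x n - l x) < eps.
Proof.
  intros He Hu. induction xs as [|y xs [N IH]]; [now exists O|].
  destruct (Hu y eps He) as [N' HN']. exists (max N N').
  intros n x Hn [->|Hx]; [apply HN'; lia|apply IH; [lia|easy]].
Qed.

(** The partial sum of the expansion of [g] up to [n N] lies in the span, as the terms off the range
    vanish; since N <= n N, this cut lies beyond the index found for convergence. *)
Lemma supported_in_closed_span (n : nat -> nat) (g : X -> R) : strictly_incr n ->
  in_dual X g -> (forall k, (forall j, n j <> k) -> g (e k) = 0) -> wstar_closed_span X es n g.
Proof.
  intros Hn Dg Hz. split; [easy|]. intros xs eps He.
  destruct (Un_cv_common_index _ _ xs eps He (es_basis g Dg)) as [N HN].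
  exists (dsum X (fun j x => g (e (n j)) * es (n j) x) N). split.
  - now exists N, (fun j => g (e (n j))).
  - intros x Hx. unfold dsum.
    rewrite <- (psum_subsequence n (fun k => g (e k) * es k x)); [apply HN|easy|].
    + clear - Hn. induction N as [|N IH]; [lia|]. specialize (Hn N). lia.
    + easy.
    + intros k Hk. rewrite Hz by easy. ring.
Qed.

Lemma Ks_upper (r : R) : Ks_set X e es r -> r <= Ks X e es.
Proof.
  intros Hr. apply (Rsup_lub (Ks_set X e es)); [easy|now exists r|easy].
Qed.

Lemma shift_operator (n : nat -> nat) : strictly_incr n ->
  exists M, bounded_op X M /\ 0 <= opnorm X M <= Ks X e es /\
    (forall f, in_dual X f -> dnorm X (M f) <= Ks X e es * dnorm X f) /\
    (forall f, in_dual X f -> forall j, M f (e (n j)) = f (e j)) /\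
    (forall f, in_dual X f -> forall k, (forall j, n j <> k) -> M f (e k) = 0).
Proof.
  intros Hn. destruct (proj2 es_subsym n Hn) as (M & Minv & HM).
  assert (HK : opnorm X M <= Ks X e es).
  { apply Ks_upper. exists n, M, Minv. auto. }
  destruct HM as (HM & Hsum & _). exists M. split; [easy|].
  destruct (bounded_op_const X M HM) as (C & HC0 & HC).
  split; [split; [now apply (opnorm_le X M C)|easy]|].
  split; [|split].
  - intros f Df. pose proof (dnorm_ge0 X f Df).
    apply Rle_trans with (opnorm X M * dnorm X f); [|nra].
    apply opnorm_on_bound; [| |now exists C|easy].
    + intros g Dg. split; [easy|now apply HM].
    + intros c g Dg. split; [now apply in_dual_scal|now apply HM].
  - intros f Df j. apply (wstar_sum_sub_coord n (fun j => f (e j))); [|now apply Hsum].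
    intros i. now apply strictly_incr_inj.
  - intros f Df k Hk. now apply (wstar_sum_off_range n (fun j => f (e j))); [|apply Hsum].
Qed.

(** The shift along the identity sequence fixes [es O], which has norm 1. *)
Lemma Ks_ge1 : 1 <= Ks X e es.
Proof.
  destruct (shift_operator (fun j => j)) as (M & HM & _ & HK & Hc & _).
  { intros i. lia. }
  pose proof (HK (es O) (es_dual O)) as H. rewrite es_norm, Rmult_1_r in H.
  eapply Rle_trans; [|exact H].
  replace (M (es O)) with (es O); [rewrite es_norm; lra|].
  apply dual_ext; [apply es_dual|apply HM, es_dual|]. intros j. now rewrite Hc by apply es_dual.
Qed.

(** A 0-1 multiplier, at cost [Ku], cuts [f] down to the range of [n] and so places it in the weak*
    closed span; the inverse shift, at cost [Ks], then relabels the coordinates. The factor 1 fits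
    the format of [coord_operator]. *)
Lemma subsequence_functional (n : nat -> nat) (f : X -> R) : strictly_incr n -> in_dual X f ->
  exists g, in_dual X g /\ (forall j, g (e j) = 1 * f (e (n j))) /\
    dnorm X g <= Ks X e es * Ku X es * dnorm X f.
Proof.
  intros Hn Df.
  destruct (multiplier (fun k => if excluded_middle_informative (exists j, n j = k) then 1 else 0)
    1 f) as (h & Dh & Hh & Nh); [|easy|].
  { intros k. destruct (excluded_middle_informative _); rewrite ?Rabs_R0, ?Rabs_R1; lra. }
  assert (Sh : wstar_closed_span X es n h).
  { apply supported_in_closed_span; try easy. intros k Hk. rewrite Hh.
    destruct (excluded_middle_informative _) as [[j Hj]|]; [now destruct (Hk j)|ring]. }
  destruct (proj2 es_subsym n Hn) as (M & Minv & HM).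
  assert (HK : opnorm_on X (wstar_closed_span X es n) Minv <= Ks X e es).
  { apply Ks_upper. exists n, M, Minv. auto. }
  destruct HM as (HM & Hsum & Hsp & Hinv & Hinv2 & HC).
  destruct (Hinv2 h Sh) as [Dg Eg]. exists (Minv h). split; [easy|split].
  - intros j. rewrite <- (wstar_sum_sub_coord n (fun j => Minv h (e j)) h).
    + rewrite Hh. destruct (excluded_middle_informative _) as [|Hx]; [easy|].
      exfalso. apply Hx. now exists j.
    + intros i. now apply strictly_incr_inj.
    + pose proof (Hsum (Minv h) Dg) as Hs. now rewrite Eg in Hs.
  - eapply Rle_trans; [apply (opnorm_on_bound X (wstar_closed_span X es n))|]; [| |exact HC|easy|].
    + intros g Sg. split; [apply Sg|now apply Hinv2].
    + intros c g Sg. split; [now apply wstar_closed_span_scal|].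
      destruct (Hinv2 g Sg) as [D1 E1]. rewrite <- E1 at 1.
      rewrite <- (proj1 (proj2 (proj2 HM))) by easy. apply Hinv. now apply in_dual_scal.
    + pose proof (dnorm_ge0 X h Dh). pose proof Ks_ge1.
      apply Rle_trans with (Ks X e es * dnorm X h); [now apply Rmult_le_compat_r|].
      rewrite Rmult_assoc. apply Rmult_le_compat_l; lra.
Qed.

Lemma subsequence_operator (n : nat -> nat) : strictly_incr n ->
  exists Q, bounded_op X Q /\ (forall f, in_dual X f -> forall j, Q f (e j) = f (e (n j))) /\
    forall f, in_dual X f -> dnorm X (Q f) <= Ks X e es * Ku X es * dnorm X f.
Proof.
  intros Hn. destruct (coord_operator n (fun _ => 1) (Ks X e es * Ku X es)) as (Q & HQ & Hc & HK).
  - intros f Df. now apply subsequence_functional.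
  - exists Q. split; [easy|split; [|easy]]. intros f Df j. rewrite Hc by easy. ring.
Qed.

Lemma multiplier_operator (c : nat -> R) (B : R) : (forall j, Rabs (c j) <= B) ->
  exists D, bounded_op X D /\ (forall f, in_dual X f -> forall j, D f (e j) = c j * f (e j)) /\
    forall f, in_dual X f -> dnorm X (D f) <= Ku X es * B * dnorm X f.
Proof. intros HB. apply coord_operator. intros f Df. now apply multiplier. Qed.

(** * Condition (C) *)

Hypothesis es_condC : condC X e es.

(** Predicate form of [infinite_set], suited to index sets given by propositions; the boolean form
    is recovered classically when (C) is applied. *)
Definition infinite (P : nat -> Prop) : Prop := forall m, exists k, (m <= k)%nat /\ P k.

Definition supported (P : nat -> Prop) (g : X -> R) : Prop := forall k, ~ P k -> g (e k) = 0.

(** An element of the bidual of norm at most [K]; no weak* continuity is asked for. *)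
Definition functional (K : R) (phi : (X -> R) -> R) : Prop :=
  (forall f g, in_dual X f -> in_dual X g -> phi (dadd X f g) = phi f + phi g) /\
  (forall c f, in_dual X f -> phi (dscal X c f) = c * phi f) /\
  (forall f, in_dual X f -> Rabs (phi f) <= K * dnorm X f).

Lemma functional_sum (K : R) (phi : (X -> R) -> R) (c : nat -> R) (F : nat -> X -> R) (N : nat) :
  functional K phi -> (forall j, in_dual X (F j)) ->
  phi (dsum X (fun j => dscal X (c j) (F j)) N) = psum (fun j => c j * phi (F j)) N.
Proof.
  intros (Pa & Ps & _) HF.
  assert (HcF : forall j, in_dual X (dscal X (c j) (F j))) by (intros; now apply in_dual_scal).
  induction N as [|N IH].
  - simpl. replace (dsum X _ 0) with (dscal X 0 (dzero X)).
    + rewrite Ps by apply in_dual_zero. ring.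
    + extensionality x. unfold dscal, dsum, dzero. simpl. ring.
  - rewrite dsum_S, Pa, Ps, IH by (try apply in_dual_sum; auto). easy.
Qed.

(** The value 1 at 0 keeps the modulus equal to 1 everywhere. *)
Definition sgn (r : R) : R := if Rle_dec 0 r then 1 else -1.

Lemma sgn_mul (r : R) : sgn r * r = Rabs r.
Proof.
  unfold sgn. destruct (Rle_dec 0 r); [rewrite Rabs_right|rewrite Rabs_left]; lra.
Qed.

Lemma Rabs_sgn (r : R) : Rabs (sgn r) = 1.
Proof. unfold sgn. destruct (Rle_dec 0 r); [rewrite Rabs_right|rewrite Rabs_left]; lra. Qed.

(* Otherwise the [l^1]-combination of the [x j] provided by (C), after truncation to [j < N]
   and correction of the signs by a multiplier, would be small in norm but large under [phi].
   The bound [N] depends only on the [x j], not on [phi]. *)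
Lemma condC_small_value (Lam : nat -> Prop) (eps K : R) : infinite Lam -> 0 < eps -> 0 <= K ->
  exists A : nat -> nat -> Prop,
    (forall j k, A j k -> Lam k) /\ (forall j, infinite (A j)) /\
    forall x : nat -> X -> R,
      (forall j, in_dual X (x j) /\ dnorm X (x j) <= 1 /\ supported (A j) (x j)) ->
      exists N, forall phi, functional K phi -> exists j, (j < N)%nat /\ Rabs (phi (x j)) <= eps.
Proof.
  intros HL He HK. pose proof Ku_ge1 as HKu.
  set (Lb := fun k => if excluded_middle_informative (Lam k) then true else false).
  assert (HLb : forall k, Lb k = true <-> Lam k).
  { intros k. unfold Lb. destruct (excluded_middle_informative (Lam k)); split; intros; easy. }
  assert (HKK : 0 <= K * Ku X es) by (apply Rmult_le_pos; lra).
  (* A vector of norm [theta], after a multiplier costing [Ku], must have a value below eps/2 under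
     [phi]; the summand 1 keeps the denominator positive. *)
  set (theta := eps / (2 * (K * Ku X es + 1))).
  assert (Hth : 0 < theta) by (apply Rdiv_lt_0_compat; lra).
  assert (Hsmall : K * Ku X es * theta < eps / 2).
  { replace (eps / 2) with ((K * Ku X es + 1) * theta) by (unfold theta; field; lra).
    apply Rmult_lt_compat_r; lra. }
  destruct (es_condC Lb) with (theta := theta) as (A & HAL & HAi & HAd & HA); [|easy|].
  { intros m. destruct (HL m) as (k & Hk & Lk). exists k. split; [easy|now apply HLb]. }
  exists (fun j k => A j k = true). split; [|split; [easy|]].
  { intros j k Hjk. apply HLb. eapply HAL, Hjk. }
  intros x Hx. destruct (HA x) as (a & Ha & G & HG & g & Dg & Hg & Ng).
  { intros j. split; apply Hx. }
  assert (EG : forall j, G j = x j).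
  { intros j. destruct (Hx j) as (Dx & _ & Sx). destruct (HG j) as [DG Hs].
    apply dual_ext; [easy..|]. intros k. rewrite (wstar_sum_coord _ _ k Hs).
    destruct (A j k) eqn:Ejk; [easy|]. symmetry. apply Sx. now rewrite Ejk. }
  (* The first [N] coefficients carry more than half of the l^1 norm; [phi] has not yet been
     introduced. *)
  destruct (Ha (/ 2)) as [N HN]; [lra|]. specialize (HN N (Nat.le_refl N)).
  unfold Rdist in HN. apply Rabs_def2 in HN.
  exists N. intros phi Hphi. apply NNPP. intros Hno.
  assert (Hbig : forall j, (j < N)%nat -> eps <= Rabs (phi (x j))).
  { intros j Hj. apply Rnot_lt_le. intros Hlt. apply Hno. exists j. split; [easy|lra]. }
  set (t := fun j => if Nat.ltb j N then sgn (a j) * sgn (phi (x j)) else 0).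
  assert (Ht : forall j, Rabs (t j) <= 1).
  { intros j. unfold t. destruct (Nat.ltb j N); rewrite ?Rabs_mult, ?Rabs_sgn, ?Rabs_R0; lra. }
  (* [gam] is constant equal to [t j] on [A j]; the index picked by [epsilon] is the only possible
     one because the sets are disjoint. *)
  set (gam := fun k => if excluded_middle_informative (exists j, A j k = true)
     then t (epsilon (inhabits O) (fun j => A j k = true)) else 0).
  assert (Hgam1 : forall k, Rabs (gam k) <= 1).
  { intros k. unfold gam. destruct (excluded_middle_informative _); [apply Ht|rewrite Rabs_R0; lra]. }
  assert (Hgam2 : forall j k, A j k = true -> gam k = t j).
  { intros j k Hjk. unfold gam. destruct (excluded_middle_informative _) as [Hex|Hex].
    - pose proof (epsilon_spec (inhabits O) (fun j => A j k = true) Hex) as Hs. cbv beta in Hs.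
      set (i := epsilon _ _) in *. destruct (Nat.eq_dec i j) as [->|Hij]; [easy|].
      now rewrite (HAd i j k Hij Hs) in Hjk.
    - exfalso. apply Hex. now exists j. }
  assert (Hterm : forall j k, gam k * (a j * G j (e k)) = t j * a j * x j (e k)).
  { intros j k. rewrite EG. destruct (A j k) eqn:Ejk.
    - rewrite (Hgam2 j k Ejk). ring.
    - destruct (Hx j) as (_ & _ & Sx). rewrite (Sx k) by now rewrite Ejk. ring. }
  destruct (multiplier gam 1 g Hgam1 Dg) as (h & Dh & Hh & Nh).
  assert (Dx : forall j, in_dual X (x j)) by (intros j; apply Hx).
  (* The multiplier truncates as well: [t j] is 0 for j >= N, so [phi] needs to be evaluated only on
     a finite sum. *)
  assert (Eh : h = dsum X (fun j => dscal X (t j * a j) (x j)) N).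
  { apply dual_ext; [easy|apply in_dual_sum; intros; now apply in_dual_scal|].
    intros k. rewrite Hh. eapply UL_sequence; [apply Un_cv_scal, (Hg (e k))|].
    apply Un_cv_const_eventually with N. intros n Hn.
    rewrite <- psum_scal. unfold dsum, dscal. induction Hn as [|n Hn IH].
    - apply psum_ext. intros. apply Hterm.
    - simpl. rewrite IH, Hterm. unfold t at 2. rewrite (proj2 (Nat.ltb_ge n N)) by lia. ring. }
  assert (Hlow : eps * / 2 <= phi h).
  { rewrite Eh, (functional_sum K) by easy.
    apply Rle_trans with (eps * psum (fun j => Rabs (a j)) N); [apply Rmult_le_compat_l; lra|].
    rewrite <- psum_scal. apply psum_le. intros j Hj.
    unfold t. rewrite (proj2 (Nat.ltb_lt j N)) by lia.
    replace (sgn (a j) * sgn (phi (x j)) * a j * phi (x j))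
      with ((sgn (a j) * a j) * (sgn (phi (x j)) * phi (x j))) by ring.
    rewrite !sgn_mul, Rmult_comm. apply Rmult_le_compat_l; [apply Rabs_pos|auto]. }
  destruct Hphi as (_ & _ & Hphi). pose proof (Hphi h Dh) as Hup.
  pose proof (Rle_abs (phi h)). pose proof (dnorm_ge0 X g Dg).
  assert (K * dnorm X h <= K * (Ku X es * theta)); [|lra].
  apply Rmult_le_compat_l; [easy|]. eapply Rle_trans; [exact Nh|].
  rewrite Rmult_1_r. apply Rmult_le_compat_l; lra.
Qed.

(** One of the sets provided by (C) works: otherwise each carries a vector of norm at most 1 on
    which [phi] exceeds [eps], against [condC_small_value]. *)
Lemma functional_small_on_subset (Lam : nat -> Prop) (eps K : R) (phi : (X -> R) -> R) :
  infinite Lam -> 0 < eps -> 0 <= K -> functional K phi ->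
  exists A, infinite A /\ (forall k, A k -> Lam k) /\
    forall g, in_dual X g -> supported A g -> Rabs (phi g) <= eps * dnorm X g.
Proof.
  intros HL He HK Hphi.
  destruct (condC_small_value Lam eps K HL He HK) as (A & HAL & HAi & HA).
  apply NNPP. intros Hno.
  assert (Hx : forall j, exists x, (in_dual X x /\ dnorm X x <= 1 /\ supported (A j) x) /\
     eps < Rabs (phi x)).
  { intros j. apply NNPP. intros Hj. apply Hno. exists (A j).
    split; [easy|split; [apply HAL|]]. intros g Dg Sg. apply Rnot_lt_le. intros Hlt.
    pose proof Hphi as (_ & Ps & Pb).
    destruct (dnorm_ge0 X g Dg) as [Hpos|H0].
    - apply Hj. exists (dscal X (/ dnorm X g) g).
      assert (Hinv : 0 < / dnorm X g) by now apply Rinv_0_lt_compat.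
      split; [split; [now apply in_dual_scal|split]|].
      + eapply Rle_trans; [now apply dnorm_scal_le|]. rewrite Rabs_right by lra.
        right. field. lra.
      + intros k Hk. unfold dscal. rewrite Sg by easy. ring.
      + rewrite Ps, Rabs_mult, Rabs_right by (easy || lra).
        apply Rmult_lt_reg_l with (dnorm X g); [easy|].
        replace (dnorm X g * (/ dnorm X g * Rabs (phi g))) with (Rabs (phi g)) by (field; lra). lra.
    - specialize (Pb g Dg). rewrite <- H0 in *. lra. }
  apply choice in Hx. destruct Hx as [x Hx].
  destruct (HA x) as [N HN]; [intros j; apply Hx|].
  destruct (HN phi Hphi) as (j & _ & Hj). destruct (Hx j) as [_ Hx2]. lra.
Qed.

(** * Almost diagonal subsequences *)

Section Operator.
Variable H : (X -> R) -> X -> R.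
Hypothesis H_bounded : bounded_op X H.

Lemma functional_eval (K : R) (k : nat) : 0 <= K ->
  (forall f, in_dual X f -> dnorm X (H f) <= K * dnorm X f) ->
  functional K (fun f => H f (e k)).
Proof.
  intros HK0 HK. destruct H_bounded as (Hd & Ha & Hs & _). split; [|split]; intros.
  - now rewrite Ha.
  - now rewrite Hs.
  - eapply Rle_trans; [apply coord_le|]; auto.
Qed.

Lemma functional_eval_sub (K : R) (k l : nat) : 0 <= K ->
  (forall f, in_dual X f -> dnorm X (H f) <= K * dnorm X f) ->
  functional (2 * K) (fun f => H f (e k) - H f (e l)).
Proof.
  intros HK0 HK. destruct (functional_eval K k HK0 HK) as (A1 & S1 & B1).
  destruct (functional_eval K l HK0 HK) as (A2 & S2 & B2). split; [|split].
  - intros f g Df Dg. rewrite A1, A2 by easy. ring.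
  - intros c f Df. rewrite S1, S2 by easy. ring.
  - intros f Df. specialize (B1 f Df). specialize (B2 f Df).
    unfold Rminus. eapply Rle_trans; [apply Rabs_triang|]. rewrite Rabs_Ropp. lra.
Qed.

(** Otherwise pick k_j in A_j; each column of index k_j exceeds [eps] at all rows of [Lam] beyond
    some b_j. A row [m] in [Lam] beyond b_j for all j < N then contradicts (C). Since [m] is chosen
    after [N], it matters that [N] does not depend on the functional. *)
Lemma small_column (Lam : nat -> Prop) (eps : R) : infinite Lam -> 0 < eps ->
  exists k, Lam k /\ infinite (fun m => Lam m /\ Rabs (H (es k) (e m)) <= eps).
Proof.
  intros HL He. destruct (bounded_op_const X H H_bounded) as (K & HK0 & HK).
  destruct (condC_small_value Lam eps K HL He HK0) as (A & HAL & HAi & HA).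
  apply NNPP. intros Hno.
  assert (Hth : forall k, Lam k -> exists b, forall m, (b <= m)%nat -> Lam m ->
     eps < Rabs (H (es k) (e m))).
  { intros k Hk. apply NNPP. intros Hk2. apply Hno. exists k. split; [easy|].
    intros b. apply NNPP. intros Hb. apply Hk2. exists b. intros m Hm Lm.
    apply Rnot_le_lt. intros Hle. apply Hb. now exists m. }
  assert (Hk : exists k : nat -> nat, forall j, A j (k j)).
  { apply (choice (fun j k => A j k)). intros j. destruct (HAi j O) as (k & _ & Hk). now exists k. }
  destruct Hk as [k Hk].
  assert (Hb : exists b : nat -> nat, forall j m, (b j <= m)%nat -> Lam m ->
     eps < Rabs (H (es (k j)) (e m))).
  { apply (choice (fun j b => forall m, (b <= m)%nat -> Lam m ->
      eps < Rabs (H (es (k j)) (e m)))). intros j. apply Hth. eapply HAL, Hk. }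
  destruct Hb as [b Hb].
  destruct (HA (fun j => es (k j))) as [N HN].
  { intros j. split; [apply es_dual|split; [rewrite es_norm; lra|]].
    intros i Hi. rewrite es_e. destruct (Nat.eqb_spec i (k j)) as [->|]; [now destruct Hi|easy]. }
  assert (Hmax : forall M, exists B, forall j, (j < M)%nat -> (b j <= B)%nat).
  { induction M as [|M [B IH]]; [now exists O|]. exists (max B (b M)). intros j Hj.
    destruct (Nat.eq_dec j M) as [->|]; [lia|]. specialize (IH j). lia. }
  destruct (Hmax N) as [B HB]. destruct (HL B) as (m & Hm & Lm).
  destruct (HN _ (functional_eval K m HK0 HK)) as (j & Hj & Hle).
  specialize (HB j Hj). specialize (Hb j m ltac:(lia) Lm). lra.
Qed.

(** Along [Lam] the values are eventually below the limit superior plus delta/2 and infinitely often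
    above it minus delta/2; the indices satisfying both are kept. *)
Lemma bounded_small_oscillation (f : nat -> R) (B : R) (Lam : nat -> Prop) (delta : R) :
  infinite Lam -> (forall k, Rabs (f k) <= B) -> 0 < delta ->
  exists L, infinite L /\ (forall k, L k -> Lam k) /\
    forall k l, L k -> L l -> Rabs (f k - f l) <= delta.
Proof.
  intros HL HB Hd.
  (* [c] is the limit superior of [f] along [Lam]. *)
  destruct (completeness (fun x => infinite (fun k => Lam k /\ x <= f k))) as [c [Hc1 Hc2]].
  - exists B. intros x Hx. destruct (Hx O) as (k & _ & _ & Hk).
    pose proof (Rle_abs (f k)). specialize (HB k). lra.
  - exists (- B). intros m. destruct (HL m) as (k & Hk & Lk). exists k.
    split; [easy|split; [easy|]]. specialize (HB k). pose proof (Rle_abs (- f k)) as H1.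
    rewrite Rabs_Ropp in H1. lra.
  - assert (Hlow : exists x, c - delta / 2 < x /\ infinite (fun k => Lam k /\ x <= f k)).
    { apply NNPP. intros Hno. assert (c <= c - delta / 2); [|lra].
      apply Hc2. intros x Hx. apply Rnot_lt_le. intros Hlt. apply Hno. now exists x. }
    destruct Hlow as (x & Hx & Ix).
    assert (Hup : exists m0, forall k, (m0 <= k)%nat -> Lam k -> f k < c + delta / 2).
    { apply NNPP. intros Hno. assert (c + delta / 2 <= c); [|lra].
      apply Hc1. intros m. apply NNPP. intros Hm. apply Hno. exists m. intros k Hk Lk.
      apply Rnot_le_lt. intros Hle. apply Hm. now exists k. }
    destruct Hup as [m0 Hm0].
    exists (fun k => (m0 <= k)%nat /\ Lam k /\ x <= f k). split; [|split].
    + intros m. destruct (Ix (max m m0)) as (k & Hk & Lk & Hfk). exists k.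
      split; [lia|split; [lia|easy]].
    + now intros k (_ & Lk & _).
    + intros k l (Hk & Lk & Fk) (Hl & Ll & Fl).
      specialize (Hm0 k Hk Lk) as U1. specialize (Hm0 l Hl Ll) as U2.
      apply Rabs_le. lra.
Qed.

Lemma bounded_family_small_oscillation (F : nat -> nat -> R) (B : R) (b : nat)
    (Lam : nat -> Prop) (delta : R) :
  infinite Lam -> (forall p k, Rabs (F p k) <= B) -> 0 < delta ->
  exists L, infinite L /\ (forall k, L k -> Lam k) /\
    forall p k l, (p < b)%nat -> L k -> L l -> Rabs (F p k - F p l) <= delta.
Proof.
  intros HL HB Hd. induction b as [|b (L & IL & SL & OL)].
  - exists Lam. split; [easy|split; [easy|]]. lia.
  - destruct (bounded_small_oscillation (F b) B L delta IL (HB b) Hd) as (L' & IL' & SL' & OL').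
    exists L'. split; [easy|split; [auto|]]. intros p k l Hp Hk Hl.
    destruct (Nat.eq_dec p b) as [->|]; [now apply OL'|]. apply OL; auto; lia.
Qed.

(* A stage consists of the indices still available and the last pair [(n, m)] chosen. *)
Definition stage := ((nat -> Prop) * nat * nat)%type.

(** The clauses on [p] and on [g] control past and future columns of the row difference. Later
    indices are taken from [L'], so the last clause treats all future columns at once. *)
Definition stage_step (delta : R) (s s' : stage) : Prop :=
  let '(L, _, b) := s in let '(L', n, m) := s' in
  (b < n)%nat /\ (n < m)%nat /\ L n /\ (forall k, L' k -> L k) /\
  Rabs (H (es n) (e m)) <= / 8 /\
  (forall p, (p <= b)%nat -> Rabs (H (es p) (e n) - H (es p) (e m)) <= delta) /\
  (forall g, in_dual X g -> supported L' g ->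
     Rabs (H g (e n) - H g (e m)) <= delta * dnorm X g).

(** The order of choices matters: first a set on which the past columns are almost constant, then
    [n] and [m] inside it, and only then, with the row difference fixed, the smaller set left for
    the future. *)
Lemma stage_step_exists (delta : R) (s : stage) : 0 < delta -> infinite (fst (fst s)) ->
  exists s', infinite (fst (fst s')) /\ stage_step delta s s'.
Proof.
  intros Hd. destruct s as [[L n0] b]. simpl. intros HL.
  destruct (bounded_op_const X H H_bounded) as (K & HK0 & HK).
  assert (HL0 : infinite (fun k => L k /\ (b < k)%nat)).
  { intros m. destruct (HL (max m (S b))) as (k & Hk & Lk). exists k.
    split; [lia|split; [easy|lia]]. }
  (* [S b] because the past columns are those with p <= b. *)
  destruct (bounded_family_small_oscillation (fun p k => H (es p) (e k)) K (S b) _ delta HL0)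
    as (L1 & IL1 & SL1 & OL1); [|easy|].
  { intros p k. destruct (functional_eval K k HK0 HK) as (_ & _ & Hb).
    specialize (Hb (es p) (es_dual p)). rewrite es_norm in Hb. lra. }
  destruct (small_column L1 (/ 8) IL1) as (n & Ln & In); [lra|].
  destruct (In (S n)) as (m & Hm & Lm & Hnm).
  destruct (functional_small_on_subset L1 delta (2 * K) _ IL1 Hd ltac:(lra)
    (functional_eval_sub K n m HK0 HK)) as (L2 & IL2 & SL2 & H2).
  exists (L2, n, m). split; [easy|]. simpl.
  split; [now apply SL1|]. split; [lia|]. split; [now apply SL1|].
  split; [intros k Hk; now apply SL1, SL2|]. split; [easy|]. split; [|easy].
  intros p Hp. apply (OL1 p); [lia|easy..].
Qed.

(** The relation may vary with the step, as the tolerance [delta i] does; [P] is the invariant that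
    lets the construction continue. *)
Lemma dependent_choice (A : Type) (P : A -> Prop) (R : nat -> A -> A -> Prop) (a0 : A) :
  P a0 -> (forall i a, P a -> exists a', P a' /\ R i a a') ->
  exists u : nat -> A, u O = a0 /\ forall i, R i (u i) (u (S i)).
Proof.
  intros P0 Hstep.
  set (next := fun i a => epsilon (inhabits a) (fun a' => P a' /\ R i a a')).
  assert (Hnext : forall i a, P a -> P (next i a) /\ R i a (next i a)).
  { intros i a Pa. apply (epsilon_spec (inhabits a) (fun a' => P a' /\ R i a a')). auto. }
  set (u := fix u i := match i with O => a0 | S i => next i (u i) end).
  assert (Pu : forall i, P (u i)) by (induction i as [|i IH]; [easy|now apply Hnext]).
  exists u. split; [easy|]. intros i. now apply Hnext.
Qed.

Lemma almost_diagonal_subsequences (Lam : nat -> Prop) (delta : nat -> R) :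
  infinite Lam -> (forall i, 0 < delta i) ->
  exists n m : nat -> nat, strictly_incr n /\ strictly_incr m /\
    (forall i, Lam (n i)) /\ (forall i, Rabs (H (es (n i)) (e (m i))) <= / 8) /\
    (forall i j, (j < i)%nat ->
       Rabs (H (es (n j)) (e (n i)) - H (es (n j)) (e (m i))) <= delta i) /\
    (forall i g, in_dual X g -> supported (fun k => exists j, (i < j)%nat /\ n j = k) g ->
       Rabs (H g (e (n i)) - H g (e (m i))) <= delta i * dnorm X g).
Proof.
  intros HL Hd.
  destruct (dependent_choice stage (fun s => infinite (fst (fst s)))
    (fun i => stage_step (delta i)) (Lam, O, O)) as (u & Hu0 & Hu); [easy| |].
  { intros i s Hs. now apply stage_step_exists. }
  set (L := fun i => fst (fst (u i))).
  (* Stage [S i] holds the pair chosen at step [i]. The pair in stage 0 is a placeholder whose bound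
     only forces 0 < n 0. *)
  set (n := fun i => snd (fst (u (S i)))). set (m := fun i => snd (u (S i))).
  assert (Hstep : forall i, stage_step (delta i) (L i, snd (fst (u i)), snd (u i)) (L (S i), n i, m i)).
  { intros i. specialize (Hu i). unfold L, n, m.
    now destruct (u i) as [[? ?] ?], (u (S i)) as [[? ?] ?]. }
  assert (E0 : L O = Lam) by (unfold L; now rewrite Hu0).
  clearbody L. clear Hu.
  assert (Hmn : forall i, (m i < n (S i))%nat) by (intros i; apply (Hstep (S i))).
  assert (Hnm : forall i, (n i < m i)%nat) by (intros i; apply (Hstep i)).
  assert (HLmono : forall i j k, (i <= j)%nat -> L j k -> L i k).
  { intros i j k Hij. induction Hij as [|j Hij IH]; [easy|]. intros Hk.
    apply IH. now apply (Hstep j). }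
  assert (Hn : strictly_incr n) by (intros i; specialize (Hmn i); specialize (Hnm i); lia).
  exists n, m. split; [easy|]. split; [|split; [|split; [|split]]].
  - intros i. specialize (Hmn i). specialize (Hnm (S i)). lia.
  - intros i. rewrite <- E0. apply (HLmono O i); [lia|]. now destruct (Hstep i) as (_ & _ & Hk & _).
  - intros i. apply (Hstep i).
  (* For j < i the column [n j] does not exceed m (i-1), the bound recorded in stage [i]. *)
  - intros i j Hj. apply (Hstep i). destruct i as [|i]; [lia|]. change (snd (u (S i))) with (m i).
    specialize (Hnm i). destruct (Nat.eq_dec j i) as [->|]; [lia|].
    pose proof (strictly_incr_lt n j i Hn ltac:(lia)). lia.
  (* The available sets decrease, so every [n j] with j > i lies in L (S i). *)
  - intros i g Dg Sg. apply (Hstep i); [easy|]. intros k Hk. apply Sg.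
    intros (j & Hj & <-). apply Hk. apply (HLmono (S i) j); [lia|]. now destruct (Hstep j) as (_ & _ & Hj' & _).
Qed.

(* The diagonal term of row [i] is isolated from the past columns, estimated one by one, and
   the future columns, estimated jointly since [H] need not be weak*-continuous. *)
Lemma row_estimate (n m : nat -> nat) (M : (X -> R) -> X -> R) (f : X -> R) (i : nat) (delta : R) :
  strictly_incr n -> in_dual X f -> in_dual X (M f) ->
  dnorm X (M f) <= Ks X e es * dnorm X f ->
  (forall j, M f (e (n j)) = f (e j)) ->
  (forall k, (forall j, n j <> k) -> M f (e k) = 0) -> 0 <= delta ->
  (forall j, (j < i)%nat -> Rabs (H (es (n j)) (e (n i)) - H (es (n j)) (e (m i))) <= delta) ->
  (forall g, in_dual X g -> supported (fun k => exists j, (i < j)%nat /\ n j = k) g ->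
     Rabs (H g (e (n i)) - H g (e (m i))) <= delta * dnorm X g) ->
  Rabs (H (M f) (e (n i)) - H (M f) (e (m i))
        - f (e i) * (H (es (n i)) (e (n i)) - H (es (n i)) (e (m i))))
    <= delta * (2 * INR i + 1 + Ks X e es) * dnorm X f.
Proof.
  intros Hn Df DM NM Hr Ho Hd Hpast Hfut.
  destruct (bounded_op_const X H H_bounded) as (K & HK0 & HK).
  set (phi := fun g => H g (e (n i)) - H g (e (m i))).
  assert (Hphi : functional (2 * K) phi) by now apply functional_eval_sub.
  (* [head] has [S i] terms, the past ones and the diagonal one, so that [tail] is supported on the
     future indices. *)
  set (head := dsum X (fun j => dscal X (f (e j)) (es (n j))) (S i)).
  assert (Dt : forall j, in_dual X (dscal X (f (e j)) (es (n j)))).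
  { intros j. apply in_dual_scal, es_dual. }
  assert (Dh : in_dual X head) by (apply in_dual_sum; auto).
  set (tail := dsub X (M f) head).
  assert (Dtl : in_dual X tail) by now apply in_dual_sub.
  assert (Eh : phi head = psum (fun j => f (e j) * phi (es (n j))) i + f (e i) * phi (es (n i))).
  { unfold head. rewrite (functional_sum (2 * K)) by (easy || (intros; apply es_dual)). easy. }
  assert (EM : phi (M f) = phi head + phi tail).
  { replace (M f) with (dadd X head tail).
    - now apply Hphi.
    - extensionality x. unfold tail, dadd, dsub. ring. }
  assert (Stail : supported (fun k => exists j, (i < j)%nat /\ n j = k) tail).
  { intros k Hk. unfold tail, dsub, head, dsum, dscal.
    destruct (classic (exists j, n j = k)) as [[j <-]|Hk2].
    - rewrite Hr, (psum_delta n (fun j => f (e j))).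
      + rewrite (proj2 (Nat.ltb_lt j (S i))); [ring|].
        apply Nat.nle_gt. intros Hij. apply Hk. now exists j.
      + intros l. now apply strictly_incr_inj.
    - assert (Hk3 : forall j, n j <> k) by (intros j Hj; apply Hk2; now exists j).
      rewrite Ho, (psum_off_range n (fun j => f (e j))) by easy. ring. }
  pose proof (dnorm_ge0 X f Df) as Hf0.
  assert (Nhead : dnorm X head <= INR (S i) * dnorm X f).
  { unfold head. eapply Rle_trans; [now apply dnorm_sum|].
    rewrite <- psum_const. apply psum_le. intros j _.
    eapply Rle_trans; [apply dnorm_scal_le, es_dual|].
    rewrite es_norm, Rmult_1_r. now apply coord_le. }
  assert (Ntail : dnorm X tail <= (Ks X e es + INR (S i)) * dnorm X f).
  { eapply Rle_trans; [now apply dnorm_sub|]. lra. }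
  assert (Bpast : Rabs (psum (fun j => f (e j) * phi (es (n j))) i) <= INR i * (delta * dnorm X f)).
  { eapply Rle_trans; [apply psum_Rabs_le|]. rewrite <- psum_const. apply psum_le.
    intros j Hj. rewrite Rabs_mult, Rmult_comm.
    apply Rmult_le_compat; try apply Rabs_pos; [now apply Hpast|now apply coord_le]. }
  fold (phi (M f)) (phi (es (n i))). rewrite EM, Eh.
  set (past := psum _ i) in *.
  replace (past + f (e i) * phi (es (n i)) + phi tail - f (e i) * phi (es (n i)))
    with (past + phi tail) by ring.
  eapply Rle_trans; [apply Rabs_triang|].
  (* The past costs i delta and the tail, of norm at most Ks + i + 1 times that of [f], costs delta
     (Ks + i + 1); together they give the factor 2i + 1 + Ks. *)
  specialize (Hfut tail Dtl Stail). fold (phi tail) in Hfut.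
  apply Rmult_le_compat_l with (r := delta) in Ntail; [|easy].
  rewrite S_INR in Ntail. lra.
Qed.

(** * Factorization of the identity *)

Lemma identity_factors_through :
  infinite (fun k => / 2 <= Rabs (H (es k) (e k))) ->
  exists M N, bounded_op X M /\ bounded_op X N /\
    (forall f, in_dual X f -> N (H (M f)) = f) /\
    opnorm X M * opnorm X N <= 48 * Ku X es ^ 7 * Ks X e es ^ 4.
Proof.
  intros HL. pose proof Ku_ge1 as HKu. pose proof Ks_ge1 as HKs.
  (* [w i] is the factor in [row_estimate]; [delta] divides by it so that the error in row [i] is
     2^-i/16 times the norm of [f]. *)
  set (w := fun i => 2 * INR i + 1 + Ks X e es).
  assert (Hw : forall i, 0 < w i) by (intros i; unfold w; pose proof (pos_INR i); lra).
  set (delta := fun i => / 16 * (/ 2) ^ i / w i).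
  assert (Hdelta : forall i, 0 < delta i).
  { intros i. pose proof (pow_half_pos i). apply Rdiv_lt_0_compat; [lra|apply Hw]. }
  destruct (almost_diagonal_subsequences _ delta HL Hdelta)
    as (n & m & Hn & Hm & HLn & Hnm & Hpast & Hfut).
  destruct (shift_operator n Hn) as (M & HM & OM & NM & Mr & Mo).
  destruct (subsequence_operator n Hn) as (Q1 & HQ1 & Q1c & Q1n).
  destruct (subsequence_operator m Hm) as (Q2 & HQ2 & Q2c & Q2n).
  set (d := fun i => H (es (n i)) (e (n i)) - H (es (n i)) (e (m i))).
  (* The diagonal entry is at least 1/2 and the entry subtracted at most 1/8. *)
  assert (Hd : forall i, 3 / 8 <= Rabs (d i)).
  { intros i. unfold d. eapply Rle_trans; [|apply Rabs_triang_inv].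
    specialize (HLn i). specialize (Hnm i). cbv beta in HLn. lra. }
  assert (Hdinv : forall i, Rabs (/ d i) <= 8 / 3).
  { intros i. specialize (Hd i). rewrite Rabs_inv.
    replace (8 / 3) with (/ (3 / 8)) by field. apply Rinv_le_contravar; lra. }
  destruct (multiplier_operator (fun i => / d i) (8 / 3) Hdinv) as (D & HD & Dc & Dn).
  (* Here [D] is the multiplier by the inverses of the [d i], so [Q] already includes the
     normalization of the diagonal. *)
  set (Q := fun f => D (dsub X (Q1 f) (Q2 f))).
  assert (Qdiff : forall f, in_dual X f -> in_dual X (dsub X (Q1 f) (Q2 f))).
  { intros f Df. apply in_dual_sub; [now apply HQ1|now apply HQ2]. }
  assert (HQc : forall f, in_dual X f -> forall i, Q f (e i) = / d i * (f (e (n i)) - f (e (m i)))).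
  { intros f Df i. unfold Q. rewrite Dc by auto. unfold dsub. now rewrite Q1c, Q2c by easy. }
  set (c := Ku X es * (8 / 3) * (2 * (Ks X e es * Ku X es))).
  assert (HQn : forall f, in_dual X f -> dnorm X (Q f) <= c * dnorm X f).
  { intros f Df. eapply Rle_trans; [apply Dn; auto|]. unfold c.
    rewrite (Rmult_assoc (Ku X es * (8 / 3))). apply Rmult_le_compat_l; [lra|].
    eapply Rle_trans; [apply dnorm_sub; [now apply HQ1|now apply HQ2]|].
    specialize (Q1n f Df). specialize (Q2n f Df). lra. }
  assert (HQ : bounded_op X Q).
  { unfold Q. apply bounded_op_comp; [easy|].
    destruct HQ1 as (D1 & A1 & S1 & _), HQ2 as (D2 & A2 & S2 & _).
    split; [auto|split; [|split]].
    - intros f g Df Dg. rewrite A1, A2 by easy. extensionality x. unfold dsub, dadd. ring.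
    - intros a f Df. rewrite S1, S2 by easy. extensionality x. unfold dsub, dscal. ring.
    - exists (2 * (Ks X e es * Ku X es)). intros f Df.
      eapply Rle_trans; [apply dnorm_sub; auto|].
      specialize (Q1n f Df). specialize (Q2n f Df). lra. }
  destruct (near_identity_left_inverse X (fun f => Q (H (M f)))) as (B & HB & BA & Bn).
  { apply bounded_op_comp; [easy|]. now apply bounded_op_comp. }
  { intros f Df. pose proof (dnorm_ge0 X f Df) as Hf0.
    assert (DM : in_dual X (M f)) by now apply HM.
    assert (DHM : in_dual X (H (M f))) by now apply H_bounded.
    assert (DQ : in_dual X (Q (H (M f)))) by now apply HQ.
    (* Coordinate [i] of the error is at most 8/3 times 2^-i/16, below 2^-i/4; [dnorm_le_l1] doubles
       the constant, which gives 1/2. *)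
    apply Rle_trans with (2 * (/ 4 * dnorm X f)); [|lra].
    apply dnorm_le_l1; [now apply in_dual_sub|lra|]. intros i.
    unfold dsub. rewrite HQc by easy.
    pose proof (row_estimate n m M f i (delta i) Hn Df DM (NM f Df) (Mr f Df) (Mo f Df)
      (Rlt_le _ _ (Hdelta i)) (Hpast i) (Hfut i)) as Hrow.
    fold (d i) (w i) in Hrow. set (y := H (M f) (e (n i)) - H (M f) (e (m i))) in *.
    specialize (Hd i). assert (Hd0 : d i <> 0).
    { intros E. rewrite E, Rabs_R0 in Hd. lra. }
    replace (f (e i) - / d i * y) with (- (/ d i * (y - f (e i) * d i))) by (field; easy).
    rewrite Rabs_Ropp, Rabs_mult.
    replace (delta i * w i) with (/ 16 * (/ 2) ^ i) in Hrow
      by (unfold delta; field; apply Rgt_not_eq, Hw).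
    apply Rle_trans with (8 / 3 * (/ 16 * (/ 2) ^ i * dnorm X f)).
    - apply Rmult_le_compat; auto using Rabs_pos.
    - pose proof (pow_half_pos i). nra. }
  exists M, (fun g => B (Q g)).
  assert (HN : bounded_op X (fun g => B (Q g))) by now apply bounded_op_comp.
  split; [easy|split; [easy|split; [easy|]]].
  assert (Hc0 : 0 <= Ku X es * Ku X es * Ks X e es).
  { apply Rmult_le_pos; [apply Rmult_le_pos|]; lra. }
  assert (ON : 0 <= opnorm X (fun g => B (Q g)) <= 2 * c).
  { apply opnorm_le; [easy|unfold c; lra|]. intros f Df.
    eapply Rle_trans; [apply Bn; now apply HQ|]. specialize (HQn f Df). lra. }
  apply Rle_trans with (Ks X e es * (2 * c)); [apply Rmult_le_compat; lra|].
  assert (Hu : Ku X es ^ 2 <= Ku X es ^ 7) by (apply Rle_pow; [easy|lia]).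
  assert (Hs : Ks X e es ^ 2 <= Ks X e es ^ 4) by (apply Rle_pow; [easy|lia]).
  assert (Hu0 : 0 <= Ku X es ^ 2) by (apply pow_le; lra).
  assert (Hs0 : 0 <= Ks X e es ^ 2) by (apply pow_le; lra).
  (* The norms multiply to at most 32/3 Ku^2 Ks^2: [Ks] from [M], 2 from [B] and 16/3 Ku^2 Ks from
     [Q]. Both constants are at least 1, so the powers may be raised. *)
  apply Rle_trans with (48 * (Ku X es ^ 2 * Ks X e es ^ 2)).
  - replace (Ks X e es * (2 * c)) with (32 / 3 * (Ku X es ^ 2 * Ks X e es ^ 2))
      by (unfold c; field).
    apply Rmult_le_compat_r; [now apply Rmult_le_pos|lra].
  - rewrite Rmult_assoc. apply Rmult_le_compat_l; [lra|]. now apply Rmult_le_compat.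
Qed.

End Operator.
End Subsymmetric.
End Unconditional.
End WeakStarBasis.

(** * A complemented copy of the dual in the range *)

Section ComplementedCopy.
Variables (X : NormedSpace) (H M N : (X -> R) -> X -> R).
Hypothesis H_bounded : bounded_op X H.
Hypothesis M_bounded : bounded_op X M.
Hypothesis N_bounded : bounded_op X N.
Hypothesis NHM : forall f, in_dual X f -> N (H (M f)) = f.

(** The copy is the range of J = HM. As NJ is the identity, [N] inverts [J] there and JN is a
    projection onto it. *)
Lemma complemented_copy_in_range :
  exists Y : (X -> R) -> Prop, dual_subspace X Y /\
    (forall g, Y g -> exists f, in_dual X f /\ H f = g) /\
    iso_to_dual X Y /\ complemented X Y.
Proof.
  set (J := fun f => H (M f)).
  assert (HJ : bounded_op X J) by now apply (bounded_op_comp X H M).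
  exists (fun g => exists f, in_dual X f /\ J f = g).
  pose proof HJ as (Jd & Ja & Js & _).
  split; [|split; [|split]].
  - split; [|split; [|split]].
    + intros g (f & Df & <-). auto.
    + exists (dzero X). split; [apply in_dual_zero|now apply bounded_op_zero].
    + intros g h (f & Df & <-) (k & Dk & <-). exists (dadd X f k).
      split; [now apply in_dual_add|now apply Ja].
    + intros c g (f & Df & <-). exists (dscal X c f).
      split; [now apply in_dual_scal|now apply Js].
  - intros g (f & Df & <-). exists (M f). split; [now apply M_bounded|easy].
  - exists J, N. split; [easy|split; [|split; [easy|split]]].
    + intros f Df. now exists f.
    + intros g (f & Df & <-). unfold J at 1 3. now rewrite NHM.
    + destruct N_bounded as (_ & _ & _ & [C HC]). exists C. intros g (f & Df & <-). auto.
  - exists (fun g => J (N g)). split; [now apply (bounded_op_comp X J N)|split].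
    + intros f Df. exists (N f). split; [now apply N_bounded|easy].
    + intros g (f & Df & <-). unfold J at 2. now rewrite NHM.
Qed.

End ComplementedCopy.

(** * The choice between the operator and its complement to the identity *)

Lemma infinite_or (P Q : nat -> Prop) :
  (forall k, P k \/ Q k) -> infinite P \/ infinite Q.
Proof.
  intros HPQ. destruct (classic (infinite P)) as [HP|HP]; [now left|right].
  intros m. apply NNPP. intros HQ. apply HP. intros b.
  exists (max b m). split; [lia|]. destruct (HPQ (max b m)) as [|Hq]; [easy|].
  exfalso. apply HQ. exists (max b m). split; [lia|easy].
Qed.

Theorem theorem1p1 (S : NormedSpace) (s : nat -> S) (ss : nat -> S -> R) :
  complete S ->
  is_basis S s -> (forall j, nv_norm (s j) = 1) ->
  coord_functionals S s ss -> (forall j, dnorm S (ss j) = 1) ->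
  wstar_basis S s ss -> subsymmetric S s ss ->
  (exists B, forall r, Ks_set S s ss r -> r <= B) ->
  condC S s ss ->
  forall T : (S -> R) -> (S -> R), bounded_op S T ->
  exists H : (S -> R) -> (S -> R),
    (H = T \/ H = (fun f => dsub S f (T f))) /\
    (exists M N : (S -> R) -> (S -> R),
        bounded_op S M /\ bounded_op S N /\
        (forall f, in_dual S f -> N (H (M f)) = f) /\
        opnorm S M * opnorm S N <= 48 * Ku S ss ^ 7 * Ks S s ss ^ 4) /\
    (exists Y : (S -> R) -> Prop,
        dual_subspace S Y /\
        (forall g, Y g -> exists f, in_dual S f /\ H f = g) /\
        iso_to_dual S Y /\ complemented S Y).
Proof.
  intros _ _ Hs1 Hc Hss1 Hb Hsub HKs HC T HT.
  assert (Hmain : forall H, bounded_op S H -> infinite (fun k => / 2 <= Rabs (H (ss k) (s k))) ->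
    (exists M N : (S -> R) -> (S -> R),
        bounded_op S M /\ bounded_op S N /\
        (forall f, in_dual S f -> N (H (M f)) = f) /\
        opnorm S M * opnorm S N <= 48 * Ku S ss ^ 7 * Ks S s ss ^ 4) /\
    (exists Y : (S -> R) -> Prop,
        dual_subspace S Y /\
        (forall g, Y g -> exists f, in_dual S f /\ H f = g) /\
        iso_to_dual S Y /\ complemented S Y)).
  { intros H HH Hinf.
    destruct (identity_factors_through S s ss Hs1 Hc Hss1 Hb (proj1 Hsub) Hsub HKs HC H HH Hinf)
      as (M & N & HM & HN & HNHM & Hbd).
    split; [now exists M, N|]. now apply complemented_copy_in_range with M N. }
  set (T' := fun f => dsub S f (T f)).
  destruct (infinite_or (fun k => / 2 <= Rabs (T (ss k) (s k)))
    (fun k => / 2 <= Rabs (T' (ss k) (s k)))) as [Hi|Hi].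
  - intros k. unfold T', dsub. rewrite (proj2 (Hc k)), Nat.eqb_refl.
    destruct (Rle_dec (/ 2) (Rabs (T (ss k) (s k)))) as [|Hlt]; [now left|right].
    pose proof (Rabs_triang_inv 1 (T (ss k) (s k))) as Ht. rewrite Rabs_R1 in Ht. lra.
  - exists T. split; [now left|now apply Hmain].
  - exists T'. split; [now right|apply Hmain; [now apply bounded_op_id_minus|easy]].
Qed.
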